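(* Let $k$ be a field, and let $A$ and $B$ be finite dimensional $k$-algebras (of infinite global dimension). Let $({}_AM_B,{}_BN_A)$ define a singular equivalence of Morita type with level $n$ between $A$ and $B$ such that $\mathrm{Hom}_A(M,A)$ has finite projective dimension as a $B$-module and $\mathrm{Hom}_B(N,B)$ has finite projective dimension as an $A$-module. Then the functors $$M\otimes_B-:\underline{\mathcal{G}_B}\to\underline{\mathcal{G}_A}\quad\text{and}\quad N\otimes_A-:\underline{\mathcal{G}_A}\to\underline{\mathcal{G}_B}$$ are equivalences, which are quasi-inverse to each other.
   Context: Conventions: $\otimes=\otimes_k$; $A^e=A\otimes A^{\mathrm{op}}$; $A\text{-}\mathrm{mod}$ is the category of finitely generated left $A$-modules and $A\text{-}\underline{\mathrm{mod}}$ its stable category modulo projectives; $\Omega^n$ denotes the $n$-th syzygy. $\mathrm{Hom}_A(M,A)$ denotes homomorphisms of left $A$-modules, a $B$-$A$-bimodule (viewed here as a left $B$-module); $\mathrm{Hom}_B(N,B)$ denotes homomorphisms of left $B$-modules, an $A$-$B$-bimodule (viewed here as a left $A$-module). Singular equivalence of Morita type with level $n$ ($n\ge 0$): a pair $(M,N)$ of a finitely generated $A$-$B$-bimodule $M$ and a finitely generated $B$-$A$-bimodule $N$ (with $k$ acting centrally) such that (1) $M$ is projective as a left $A$-module and as a right $B$-module; (2) $N$ is projective as a left $B$-module and as a right $A$-module; (3) $M\otimes_BN\cong\Omega^n_{A^e}(A)$ in $A^e\text{-}\underline{\mathrm{mod}}$ and $N\otimes_AM\cong\Omega^n_{B^e}(B)$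 in $B^e\text{-}\underline{\mathrm{mod}}$. Gorenstein dimension zero: a finitely generated $A$-module $X$ has Gorenstein dimension zero if the natural map $X\to\mathrm{Hom}_A(\mathrm{Hom}_A(X,A),A)$ is an isomorphism and $\mathrm{Ext}^i_A(X,A)=\mathrm{Ext}^i_A(\mathrm{Hom}_A(X,A),A)=0$ for all $i>0$. $\mathcal{G}_A\subset A\text{-}\mathrm{mod}$ is the full subcategory of such modules, and $\underline{\mathcal{G}_A}$ is the full subcategory of $A\text{-}\underline{\mathrm{mod}}$ given by the image of $\mathcal{G}_A$; likewise for $B$.
   Formalization: ''Quasi-inverse to each other'' is replaced by: the composites are naturally isomorphic to the n-th syzygy functors (identity if n = 0); the literal claim fails for A = B = k[x]/(x^3), n = 1, M the first bimodule syzygy of A, N = A. *)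

(* Defs.v *)
From HB Require Import structures.
From mathcomp Require Import all_boot all_order all_algebra all_field.
From mathcomp Require Import boolp.

Set Implicit Arguments.
Unset Strict Implicit.
Unset Printing Implicit Defensive.

Import GRing.Theory.
Local Open Scope ring_scope.
Local Open Scope quotient_scope.

(** A left [R]-module is an [lmodType R]; a right [R]-module is a left module
    over the opposite ring [R^c]. *)

Section Modules.
Variable R : pzRingType.
Implicit Types X Y K P : lmodType R.

Definition fin_gen X : Prop :=
  exists (n : nat) (g : 'I_n -> X),
    forall x, exists c : 'I_n -> R, x = \sum_i c i *: g i.

Definition surj (S T : Type) (p : S -> T) : Prop := forall y, exists x, p x = y.

Definition projective P : Prop :=
  forall (X Y : lmodType R) (p : {linear X -> Y}) (f : {linear P -> Y}),
    surj p -> exists g : {linear P -> X}, forall x, p (g x) = f x.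

Definition short_exact K P X (i : {linear K -> P}) (p : {linear P -> X}) :=
  [/\ injective i, surj p & forall y, p y = 0 <-> exists z, i z = y].

Fixpoint projdim_le (n : nat) X : Prop :=
  if n is m.+1 then
    exists (P K : lmodType R) (i : {linear K -> P}) (p : {linear P -> X}),
      [/\ projective P, short_exact i p & projdim_le m K]
  else projective X.

Definition finite_projdim X : Prop := exists n, projdim_le n X.

Record proj_resolution X := ProjResolution {
  res_ob : nat -> lmodType R;
  res_d : forall i, {linear res_ob i.+1 -> res_ob i};
  res_e : {linear res_ob 0 -> X};
  res_proj : forall i, projective (res_ob i);
  res_surj : surj res_e;
  res_exact0 : forall y, res_e y = 0 <-> exists z, res_d 0 z = y;
  res_exact : forall i y, res_d i y = 0 <-> exists z, res_d i.+1 z = y }.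

(* Ext^(j+1)_R(X, Y) = 0: the complex Hom_R(P, Y) is exact in degree j+1.
   By the comparison theorem the choice of the resolution P is irrelevant. *)
Definition ExtS_zero (j : nat) X Y : Prop :=
  exists P : proj_resolution X,
    forall f : {linear res_ob P j.+1 -> Y},
      (forall z, f (res_d P j.+1 z) = 0) ->
      exists g : {linear res_ob P j -> Y}, forall y, f y = g (res_d P j y).

Definition Ext_pos_zero X Y : Prop := forall j, ExtS_zero j X Y.

(* Equality of morphisms in the stable category: the difference factors
   through a (finitely generated) projective module. *)
Definition stable_eq X Y (f g : {linear X -> Y}) : Prop :=
  exists (P : lmodType R) (u : {linear X -> P}) (v : {linear P -> Y}),
    [/\ fin_gen P, projective P & forall x, f x - g x = v (u x)].

Definition stable_iso X Y : Prop :=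
  exists (f : {linear X -> Y}) (g : {linear Y -> X}),
    stable_eq (g \o f) idfun /\ stable_eq (f \o g) idfun.

(* [is_syzygy n X Y]: Y is isomorphic to Omega^n(X) in the stable category. *)
Fixpoint is_syzygy (n : nat) X Y : Prop :=
  if n is m.+1 then
    exists (P K : lmodType R) (i : {linear K -> P}) (p : {linear P -> X}),
      [/\ fin_gen P, projective P, short_exact i p & is_syzygy m K Y]
  else stable_iso Y X.

End Modules.

Definition infinite_gldim (R : pzRingType) : Prop :=
  ~ exists n, forall X : lmodType R, projdim_le n X.

Definition hom (R : pzRingType) (X Y : lmodType R) : Type := {linear X -> Y}.

Section Hom.
Variables (R : pzRingType) (X Y : lmodType R).
Local Notation H := (hom X Y).

HB.instance Definition _ := gen_eqMixin H.
HB.instance Definition _ := gen_choiceMixin H.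

Definition hom_fun (f : H) : X -> Y := (f : {linear X -> Y}).

Lemma homP (f g : H) : (forall x, hom_fun f x = hom_fun g x) -> f = g.
Proof.
rewrite /hom_fun; case: f g => f [[[f1 f2]] [f3]] [g [[[g1 g2]] [g3]]] /= /funext e.
move: f1 f2 f3 g1 g2 g3; rewrite {f}e => f1 f2 f3 g1 g2 g3.
by rewrite (Prop_irrelevance f1 g1) (Prop_irrelevance f2 g2)
  (Prop_irrelevance f3 g3).
Qed.

Definition hom_zero : H := (\0 : {linear X -> Y}).
Definition hom_opp (f : H) : H := (\- (f : {linear X -> Y}) : {linear X -> Y}).
Definition hom_add (f g : H) : H :=
  ((f : {linear X -> Y}) \+ (g : {linear X -> Y}) : {linear X -> Y}).

Lemma hom_addA : associative hom_add.
Proof. by move=> f g h; apply: homP => x; apply: addrA. Qed.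
Lemma hom_addC : commutative hom_add.
Proof. by move=> f g; apply: homP => x; apply: addrC. Qed.
Lemma hom_add0 : left_id hom_zero hom_add.
Proof. by move=> f; apply: homP => x; apply: add0r. Qed.
Lemma hom_addN : left_inverse hom_zero hom_opp hom_add.
Proof. by move=> f; apply: homP => x; apply: addNr. Qed.

HB.instance Definition _ :=
  GRing.isZmodule.Build H hom_addA hom_addC hom_add0 hom_addN.

End Hom.

Section MkLinear.
Variables (R : pzRingType) (X Y : lmodType R) (f : X -> Y).
Hypothesis f_lin : linear f.

Definition lin_fun : X -> Y := f.
HB.instance Definition _ := GRing.isLinear.Build R X Y *:%R lin_fun f_lin.
Definition mklin : {linear X -> Y} := lin_fun.

End MkLinear.

(* Hom_R(X, R) with its right R-module structure (f r)(x) = f(x) r. *)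
Definition dual (R : pzRingType) (X : lmodType R) : Type := hom X R^o.

Section Dual.
Variables (R : pzRingType) (X : lmodType R).

HB.instance Definition _ := GRing.Zmodule.on (dual X).

Lemma dual_act_linear (r : R^c) (f : dual X) :
  linear (fun x => (hom_fun f x : R) * (r : R) : R^o).
Proof.
move=> a x y; rewrite /hom_fun linearP /=.
by rewrite mulrDl /GRing.scale /= mulrA.
Qed.

Definition dual_act (r : R^c) (f : dual X) : dual X :=
  mklin (dual_act_linear r f).

Lemma dual_actA a b f : dual_act a (dual_act b f) = dual_act (a * b) f.
Proof. by apply: homP => x; apply/esym/mulrA. Qed.
Lemma dual_act1 : left_id 1 dual_act.
Proof. by move=> f; apply: homP => x; apply: mulr1. Qed.
Lemma dual_actDr : right_distributive dual_act +%R.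
Proof. by move=> r f g; apply: homP => x; apply: mulrDl. Qed.
Lemma dual_actDl f : {morph dual_act^~ f : a b / a + b}.
Proof. by move=> a b; apply: homP => x; apply: mulrDr. Qed.

HB.instance Definition _ := GRing.Zmodule_isLmodule.Build R^c (dual X)
  dual_actA dual_act1 dual_actDr dual_actDl.

Lemma eval_linear (x : X) : linear (fun f : dual X => hom_fun f x : R^c^o).
Proof. by []. Qed.

Definition biduality (x : X) : dual (dual X) := mklin (eval_linear x).

End Dual.

Definition gorenstein_dim0 (R : pzRingType) (X : lmodType R) : Prop :=
  [/\ fin_gen X, bijective (@biduality R X),
      Ext_pos_zero X R^o & Ext_pos_zero (dual X) R^c^o].

Section Tensor.
(* [rM] is the right action of R on M and [lX] the left action of R on X. *)
Variables (R : Type) (M X : zmodType) (rM : M -> R -> M) (lX : R -> X -> X).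

Definition balanced (Z : zmodType) (b : M -> X -> Z) : Prop :=
  [/\ forall m n x, b (m + n) x = b m x + b n x,
      forall m x y, b m (x + y) = b m x + b m y
    & forall m r x, b (rM m r) x = b m (lX r x)].

(* The tensor product is the group of formal sums of pairs, two of them being
   identified when no balanced biadditive map separates them. *)
Definition tsum (Z : zmodType) (b : M -> X -> Z) (s : seq (M * X)) : Z :=
  \sum_(p <- s) b p.1 p.2.

Definition tens_rel (s t : seq (M * X)) : Prop :=
  forall (Z : zmodType) (b : M -> X -> Z), balanced b -> tsum b s = tsum b t.

Definition tens_relb (s t : seq (M * X)) : bool := `[< tens_rel s t >].

Lemma tens_relb_equiv : equiv_class_of tens_relb.
Proof.
split=> [s|s t|s t u].
- by apply/asboolP.
- by apply/asboolP/asboolP=> h Z b hb; rewrite (h Z b hb).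
- by move=> /asboolP h1 /asboolP h2; apply/asboolP=> Z b hb; rewrite h1 // h2.
Qed.

Canonical tens_equiv : equiv_rel (seq (M * X)) :=
  EquivRelPack tens_relb_equiv.

Definition tens : Type := {eq_quot tens_equiv}.
HB.instance Definition _ := Choice.on tens.

Definition tclass (s : seq (M * X)) : tens := \pi_{eq_quot tens_equiv} s.
Definition trepr (t : tens) : seq (M * X) := repr (t : {eq_quot tens_equiv}).

Lemma tclassP s t : tclass s = tclass t <-> tens_rel s t.
Proof.
split=> [/eqmodP/asboolP //|h]; apply/eqmodP; exact/asboolP.
Qed.

Lemma treprK t : tclass (trepr t) = t.
Proof. exact: reprK. Qed.

Lemma trepr_class s (Z : zmodType) (b : M -> X -> Z) :
  balanced b -> tsum b (trepr (tclass s)) = tsum b s.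
Proof. by move=> hb; apply: (tclassP _ s).1 hb; apply: treprK. Qed.

Definition tzero := tclass [::].
Definition tadd s t := tclass (trepr s ++ trepr t).
Definition topp s := tclass [seq (- p.1, p.2) | p <- trepr s].

Lemma tsum_cat (Z : zmodType) (b : M -> X -> Z) s t : tsum b (s ++ t) = tsum b s + tsum b t.
Proof. exact: big_cat. Qed.

Lemma tsum_opp (Z : zmodType) (b : M -> X -> Z) s : balanced b ->
  tsum b [seq (- p.1, p.2) | p <- s] = - tsum b s.
Proof.
case=> bDl _ _; rewrite /tsum big_map -sumrN; apply: eq_bigr => p _ /=.
have b0 : b 0 p.2 = 0 by apply: (addrI (b 0 p.2)); rewrite -bDl !addr0.
by apply: (addrI (b p.1 p.2)); rewrite -bDl !subrr.
Qed.

Lemma tens_eqP s t : (forall (Z : zmodType) (b : M -> X -> Z), balanced b ->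
  tsum b (trepr s) = tsum b (trepr t)) -> s = t.
Proof. by move=> h; rewrite -(treprK s) -(treprK t); apply/tclassP. Qed.

Lemma taddA : associative tadd.
Proof.
move=> s t u; apply: tens_eqP => Z b hb.
by rewrite !(trepr_class, tsum_cat) // addrA.
Qed.
Lemma taddC : commutative tadd.
Proof.
by move=> s t; apply: tens_eqP => Z b hb; rewrite !(trepr_class, tsum_cat) // addrC.
Qed.
Lemma tadd0 : left_id tzero tadd.
Proof.
move=> s; apply: tens_eqP => Z b hb.
by rewrite !(trepr_class, tsum_cat) // /tsum big_nil add0r.
Qed.
Lemma taddN : left_inverse tzero topp tadd.
Proof.
move=> s; apply: tens_eqP => Z b hb.
by rewrite !(trepr_class, tsum_cat, tsum_opp) // addNr /tsum big_nil.
Qed.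

HB.instance Definition _ := GRing.isZmodule.Build tens taddA taddC tadd0 taddN.

Definition tpure (m : M) (x : X) : tens := tclass [:: (m, x)].

Lemma tpure_balanced : balanced tpure.
Proof.
split=> [m n x|m x y|m r x]; apply: tens_eqP => Z b hb; have [h1 h2 h3] := hb.
- by rewrite !(trepr_class, tsum_cat) // /tsum !big_seq1 h1.
- by rewrite !(trepr_class, tsum_cat) // /tsum !big_seq1 h2.
- by rewrite !trepr_class // /tsum !big_seq1 h3.
Qed.

Lemma tpureDl m n x : tpure (m + n) x = tpure m x + tpure n x.
Proof. by case: tpure_balanced. Qed.
Lemma tpureDr m x y : tpure m (x + y) = tpure m x + tpure m y.
Proof. by case: tpure_balanced. Qed.
Lemma tpureM m r x : tpure (rM m r) x = tpure m (lX r x).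
Proof. by case: tpure_balanced. Qed.

Lemma tens_ind (P : tens -> Prop) :
  P 0 -> (forall s t, P s -> P t -> P (s + t)) -> (forall m x, P (tpure m x)) ->
  forall t, P t.
Proof.
move=> P0 PD Pp t; rewrite -(treprK t); elim: (trepr t) => [|[m x] s IHs].
  exact: P0.
suff -> : tclass ((m, x) :: s) = tpure m x + tclass s by apply: PD.
apply: tens_eqP => Z b hb.
by rewrite !(trepr_class, tsum_cat) // /tsum big_cons big_seq1.
Qed.

Definition tlift (Z : zmodType) (b : M -> X -> Z) (t : tens) : Z :=
  tsum b (trepr t).

Lemma tliftE (Z : zmodType) (b : M -> X -> Z) : balanced b ->
  forall m x, tlift b (tpure m x) = b m x.
Proof. by move=> hb m x; rewrite /tlift trepr_class // /tsum big_seq1. Qed.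

Lemma tliftD (Z : zmodType) (b : M -> X -> Z) : balanced b -> {morph tlift b : s t / s + t}.
Proof. by move=> hb s t; rewrite /tlift trepr_class // tsum_cat. Qed.

Lemma tlift0 (Z : zmodType) (b : M -> X -> Z) : balanced b -> tlift b 0 = 0.
Proof. by move=> hb; rewrite /tlift trepr_class // /tsum big_nil. Qed.

Lemma tlift_addf (Z : zmodType) (b c : M -> X -> Z) t :
  tlift (fun m x => b m x + c m x) t = tlift b t + tlift c t.
Proof. by rewrite /tlift /tsum big_split. Qed.

Lemma eq_tlift (Z : zmodType) (b c : M -> X -> Z) : b =2 c -> tlift b =1 tlift c.
Proof. by move=> e t; apply: eq_bigr => p _; apply: e. Qed.

End Tensor.

Lemma balanced_tlift (R S : Type) (M X M' X' : zmodType)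
    (r : M -> R -> M) (l : R -> X -> X) (r' : M' -> S -> M') (l' : S -> X' -> X')
    (Z : zmodType) (b : M -> X -> M' -> X' -> Z) :
  (forall m' x', balanced r l (fun m x => b m x m' x')) ->
  forall t : tens r' l', balanced r l (fun m x => tlift (b m x) t).
Proof.
move=> hb t; split=> [m n x|m x y|m c x]; rewrite -?tlift_addf;
  apply: eq_tlift => m' x'; by case: (hb m' x').
Qed.

(** [envalg A B] is the algebra A (x)_k B^op; an A-B-bimodule on which k acts
    centrally is a left module over it, and A^e is [envalg A A]. *)

Section EnvelopingAlgebra.
Variables (k : fieldType) (A B : falgType k).

Definition envalg : Type :=
  tens (fun (a : A) (c : k) => c *: a) (fun (c : k) (b : B) => c *: b).
HB.instance Definition _ := GRing.Zmodule.on envalg.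

Definition epure (a : A) (b : B) : envalg := tpure _ _ a b.

Definition env_mul (s t : envalg) : envalg :=
  tlift (fun a b => tlift (fun a' b' => epure (a * a') (b' * b)) t) s.

Lemma epureDl a a' b : epure (a + a') b = epure a b + epure a' b.
Proof. exact: tpureDl. Qed.
Lemma epureDr a b b' : epure a (b + b') = epure a b + epure a b'.
Proof. exact: tpureDr. Qed.
Lemma epureZ (c : k) a b : epure (c *: a) b = epure a (c *: b).
Proof. exact: (tpureM (fun (a : A) (c : k) => c *: a)). Qed.

Lemma envalg_ind (P : envalg -> Prop) :
  P 0 -> (forall s t, P s -> P t -> P (s + t)) -> (forall a b, P (epure a b)) ->
  forall t, P t.
Proof. exact: tens_ind. Qed.

Lemma env_mul_balr a b :
  balanced (fun (a : A) (c : k) => c *: a) (fun (c : k) (b : B) => c *: b)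
    (fun a' b' => epure (a * a') (b' * b)).
Proof.
split=> [m n x|m x y|m c x].
- by rewrite mulrDr epureDl.
- by rewrite mulrDl epureDr.
- by rewrite -scalerAr -scalerAl epureZ.
Qed.

Lemma env_mul_ball (t : envalg) :
  balanced (fun (a : A) (c : k) => c *: a) (fun (c : k) (b : B) => c *: b)
    (fun a b => tlift (fun a' b' => epure (a * a') (b' * b)) t : envalg).
Proof.
apply: balanced_tlift => a' b'; split=> [m n x|m x y|m c x].
- by rewrite mulrDl epureDl.
- by rewrite mulrDr epureDr.
- by rewrite -scalerAr -scalerAl epureZ.
Qed.

Lemma env_mulE a b a' b' :
  env_mul (epure a b) (epure a' b') = epure (a * a') (b' * b).
Proof.
by rewrite /env_mul tliftE; [rewrite tliftE //; apply: env_mul_balr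
  | apply: env_mul_ball].
Qed.
Lemma env_mulDl : left_distributive env_mul +%R.
Proof. by move=> s t u; apply: tliftD; apply: env_mul_ball. Qed.
Lemma env_mulDr : right_distributive env_mul +%R.
Proof.
move=> s t u; rewrite /env_mul -tlift_addf; apply: eq_tlift => a b.
by apply: tliftD; apply: env_mul_balr.
Qed.
Lemma env_mul0l s : env_mul 0 s = 0.
Proof. by apply: (addrI (env_mul 0 s)); rewrite -env_mulDl !addr0. Qed.
Lemma env_mul0r s : env_mul s 0 = 0.
Proof. by apply: (addrI (env_mul s 0)); rewrite -env_mulDr !addr0. Qed.

Lemma env_mulA : associative env_mul.
Proof.
move=> s t u.
elim/envalg_ind: s => [|s s' h h'|a b]; first by rewrite !env_mul0l.
  by rewrite !env_mulDl h h'.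
elim/envalg_ind: t => [|t t' h h'|a' b']; first by rewrite !(env_mul0l, env_mul0r).
  by rewrite !(env_mulDl, env_mulDr) h h'.
elim/envalg_ind: u => [|u u' h h'|a'' b'']; first by rewrite !env_mul0r.
  by rewrite !env_mulDr h h'.
by rewrite !env_mulE !mulrA.
Qed.

Lemma env_mul1l : left_id (epure 1 1) env_mul.
Proof.
elim/envalg_ind=> [|s s' h h'|a b]; first exact: env_mul0r.
  by rewrite env_mulDr h h'.
by rewrite env_mulE mul1r mulr1.
Qed.
Lemma env_mul1r : right_id (epure 1 1) env_mul.
Proof.
elim/envalg_ind=> [|s s' h h'|a b]; first exact: env_mul0l.
  by rewrite env_mulDl h h'.
by rewrite env_mulE mul1r mulr1.
Qed.

HB.instance Definition _ := GRing.Zmodule_isPzRing.Build envalg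
  env_mulA env_mul1l env_mul1r env_mulDl env_mulDr.

Lemma epureM a b a' b' : epure a b * epure a' b' = epure (a * a') (b' * b).
Proof. exact: env_mulE. Qed.

End EnvelopingAlgebra.

Section Bimodule.
Variables (k : fieldType) (A B : falgType k) (M : lmodType (envalg A B)).

Definition lact (a : A) (m : M) : M := epure a 1 *: m.
Definition ract (m : M) (b : B) : M := epure 1 b *: m.

Lemma lactA a b m : lact a (lact b m) = lact (a * b) m.
Proof. by rewrite /lact scalerA epureM mulr1. Qed.
Lemma lact1 : left_id 1 lact.
Proof. by move=> m; apply: scale1r. Qed.
Lemma lactDr : right_distributive lact +%R.
Proof. by move=> a m n; apply: scalerDr. Qed.
Lemma lactDl m : {morph lact^~ m : a b / a + b}.
Proof. by move=> a b; rewrite /lact epureDl scalerDl. Qed.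

Lemma ractA m b c : ract (ract m b) c = ract m (b * c).
Proof. by rewrite /ract scalerA epureM mulr1. Qed.
Lemma ract1 m : ract m 1 = m.
Proof. exact: scale1r. Qed.
Lemma ractDl m n b : ract (m + n) b = ract m b + ract n b.
Proof. exact: scalerDr. Qed.
Lemma ractDr m b c : ract m (b + c) = ract m b + ract m c.
Proof. by rewrite /ract epureDr scalerDl. Qed.

Lemma lract a m b : lact a (ract m b) = ract (lact a m) b.
Proof. by rewrite /lact /ract !scalerA !epureM !mulr1 !mul1r. Qed.
Lemma epure_act a b m : epure a b *: m = lact a (ract m b).
Proof. by rewrite /lact /ract scalerA epureM !mulr1. Qed.
Lemma lactk (c : k) m : lact c%:A m = ract m c%:A.
Proof. by rewrite /lact epureZ. Qed.

(* M as a left A-module. *)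
Definition lres : Type := M.
HB.instance Definition _ := GRing.Zmodule.on lres.
HB.instance Definition _ :=
  GRing.Zmodule_isLmodule.Build A lres lactA lact1 lactDr lactDl.

(* M as a right B-module. *)
Definition rres : Type := M.
HB.instance Definition _ := GRing.Zmodule.on rres.
Definition ract_op (b : B^c) (m : M) : M := ract m b.
Lemma ract_opA b c m : ract_op b (ract_op c m) = ract_op (b * c) m.
Proof. exact: ractA. Qed.
Lemma ract_op1 : left_id 1 ract_op.
Proof. exact: ract1. Qed.
Lemma ract_opDr : right_distributive ract_op +%R.
Proof. by move=> b m n; apply: ractDl. Qed.
Lemma ract_opDl m : {morph ract_op^~ m : a b / a + b}.
Proof. by move=> b c; apply: ractDr. Qed.
HB.instance Definition _ :=
  GRing.Zmodule_isLmodule.Build B^c rres ract_opA ract_op1 ract_opDr ract_opDl.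

(* Hom_A(M, A) as a left B-module: (b f)(m) = f(m b). *)
Definition bidual : Type := hom lres A^o.
HB.instance Definition _ := GRing.Zmodule.on bidual.

Lemma bidual_act_linear (b : B) (f : bidual) :
  linear (fun m : lres => hom_fun f (ract m b) : A^o).
Proof.
move=> a m n; rewrite ractDl -[ract (a *: m) b](lract a m b).
exact: (linearP (f : {linear lres -> A^o})).
Qed.

Definition bidual_act (b : B) (f : bidual) : bidual :=
  mklin (bidual_act_linear b f).

Lemma bidual_actA a b f : bidual_act a (bidual_act b f) = bidual_act (a * b) f.
Proof. by apply: homP => m; rewrite /= /hom_fun /= /lin_fun /hom_fun /= /lin_fun ractA. Qed.
Lemma bidual_act1 : left_id 1 bidual_act.
Proof. by move=> f; apply: homP => m; rewrite /hom_fun /= /lin_fun ract1. Qed.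
Lemma bidual_actDr : right_distributive bidual_act +%R.
Proof. by move=> b f g; apply: homP. Qed.
Lemma bidual_actDl f : {morph bidual_act^~ f : a b / a + b}.
Proof.
move=> a b; apply: homP => m; rewrite /hom_fun /= /lin_fun ractDr.
exact: (linearD (f : {linear lres -> A^o})).
Qed.
HB.instance Definition _ := GRing.Zmodule_isLmodule.Build B bidual
  bidual_actA bidual_act1 bidual_actDr bidual_actDl.

End Bimodule.

(* A as an A-A-bimodule. *)
Section Regular.
Variables (k : fieldType) (A : falgType k).

Definition regbimod : Type := A.
HB.instance Definition _ := GRing.Zmodule.on regbimod.

Definition reg_act (z : envalg A A) (x : regbimod) : regbimod :=
  tlift (fun a b => (a : A) * (x : A) * (b : A)) z.

Lemma reg_act_bal (x : A) :
  balanced (fun (a : A) (c : k) => c *: a) (fun (c : k) (b : A) => c *: b)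
    (fun a b => a * x * b).
Proof.
split=> [m n y|m y z|m c y].
- by rewrite !mulrDl.
- by rewrite mulrDr.
- by rewrite -!scalerAl -scalerAr.
Qed.

Lemma reg_act_pure a b (x : A) : reg_act (epure a b) x = a * x * b.
Proof. exact: tliftE (reg_act_bal x) _ _. Qed.

Lemma reg_actDl x : {morph reg_act^~ x : a b / a + b}.
Proof. exact: tliftD (reg_act_bal x). Qed.
Lemma reg_actDr : right_distributive reg_act +%R.
Proof.
move=> z x y; rewrite /reg_act -tlift_addf; apply: eq_tlift => a b.
by rewrite mulrDr mulrDl.
Qed.
Lemma reg_act0l x : reg_act 0 x = 0.
Proof. exact: tlift0 (reg_act_bal x). Qed.
Lemma reg_act0r z : reg_act z 0 = 0.
Proof. by apply: (addrI (reg_act z 0)); rewrite -reg_actDr !addr0. Qed.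
Lemma reg_actA z w x : reg_act z (reg_act w x) = reg_act (z * w) x.
Proof.
elim/envalg_ind: z => [|s s' h h'|a b]; first by rewrite mul0r !reg_act0l.
  by rewrite mulrDl !reg_actDl h h'.
elim/envalg_ind: w => [|s s' h h'|a' b'].
- by rewrite mulr0 !reg_act0l reg_act0r.
- by rewrite mulrDr !reg_actDl reg_actDr h h'.
- by rewrite epureM !reg_act_pure !mulrA.
Qed.
Lemma reg_act1 : left_id 1 reg_act.
Proof. by move=> x; rewrite reg_act_pure mul1r mulr1. Qed.

HB.instance Definition _ := GRing.Zmodule_isLmodule.Build (envalg A A) regbimod
  reg_actA reg_act1 reg_actDr reg_actDl.

End Regular.

Section TensorModule.
Variables (k : fieldType) (A B : falgType k) (M : lmodType (envalg A B)).

Definition tensmod (X : lmodType B) : Type :=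
  tens (@ract k A B M) (fun (b : B) (x : X) => b *: x).

Section Action.
Variable X : lmodType B.
HB.instance Definition _ := GRing.Zmodule.on (tensmod X).

Definition mpure (m : M) (x : X) : tensmod X := tpure _ _ m x.
Definition tm_act (a : A) (t : tensmod X) : tensmod X :=
  tlift (fun m x => mpure (lact a m) x) t.

Lemma tm_act_bal a : balanced (@ract k A B M) (fun (b : B) (x : X) => b *: x)
  (fun m x => mpure (lact a m) x).
Proof.
split=> [m n x|m x y|m b x].
- by rewrite lactDr; apply: tpureDl.
- exact: tpureDr.
- by rewrite lract; apply: (tpureM (@ract k A B M)).
Qed.

Lemma mpureDl m n x : mpure (m + n) x = mpure m x + mpure n x.
Proof. exact: tpureDl. Qed.
Lemma mpureDr m x y : mpure m (x + y) = mpure m x + mpure m y.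
Proof. exact: tpureDr. Qed.
Lemma mpureM m b x : mpure (ract m b) x = mpure m (b *: x).
Proof. exact: (tpureM (@ract k A B M)). Qed.

Lemma tensmod_ind (P : tensmod X -> Prop) :
  P 0 -> (forall s t, P s -> P t -> P (s + t)) -> (forall m x, P (mpure m x)) ->
  forall t, P t.
Proof. exact: tens_ind. Qed.

Lemma tm_actE a m x : tm_act a (mpure m x) = mpure (lact a m) x.
Proof. exact: tliftE (tm_act_bal a) _ _. Qed.
Lemma tm_actDr : right_distributive tm_act +%R.
Proof. by move=> a; apply: tliftD (tm_act_bal a). Qed.
Lemma tm_act0 a : tm_act a 0 = 0.
Proof. exact: tlift0 (tm_act_bal a). Qed.
Lemma tm_actDl t : {morph tm_act^~ t : a b / a + b}.
Proof.
move=> a b; rewrite /tm_act -tlift_addf; apply: eq_tlift => m x.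
by rewrite lactDl mpureDl.
Qed.
Lemma tm_actA a b t : tm_act a (tm_act b t) = tm_act (a * b) t.
Proof.
elim/tensmod_ind: t => [|s t h h'|m x]; first by rewrite !tm_act0.
  by rewrite !tm_actDr h h'.
by rewrite !tm_actE lactA.
Qed.
Lemma tm_act1 : left_id 1 tm_act.
Proof.
elim/tensmod_ind=> [|s t h h'|m x]; first by rewrite tm_act0.
  by rewrite tm_actDr h h'.
by rewrite tm_actE lact1.
Qed.

HB.instance Definition _ := GRing.Zmodule_isLmodule.Build A (tensmod X)
  tm_actA tm_act1 tm_actDr tm_actDl.

Lemma tensmod_scaleE a m x : a *: mpure m x = mpure (lact a m) x.
Proof. exact: tm_actE. Qed.

End Action.

Section Map.
Variables (X Y : lmodType B) (f : {linear X -> Y}).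

Definition tmap_fun (t : tensmod X) : tensmod Y :=
  tlift (fun m x => mpure m (f x)) t.

Lemma tmap_bal : balanced (@ract k A B M) (fun (b : B) (x : X) => b *: x)
  (fun m x => mpure m (f x)).
Proof.
split=> [m n x|m x y|m b x].
- exact: mpureDl.
- by rewrite linearD mpureDr.
- by rewrite mpureM linearZ.
Qed.

Lemma tmap_linear : linear tmap_fun.
Proof.
move=> a s t; rewrite /tmap_fun tliftD; last exact: tmap_bal.
congr (_ + _).
elim/tensmod_ind: s => [|s s' h h'|m x].
- by rewrite scaler0 tlift0 ?scaler0 //; apply: tmap_bal.
- by rewrite scalerDr !(tliftD tmap_bal) h h' scalerDr.
- by rewrite tensmod_scaleE !(tliftE tmap_bal) tensmod_scaleE.
Qed.

Definition tmap : {linear tensmod X -> tensmod Y} := mklin tmap_linear.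

Lemma tmap0 : tmap 0 = 0.
Proof. exact: linear0. Qed.
Lemma tmapD s t : tmap (s + t) = tmap s + tmap t.
Proof. exact: linearD. Qed.
Lemma tmapE m x : tmap (mpure m x) = mpure m (f x).
Proof. exact: tliftE tmap_bal _ _. Qed.

End Map.
End TensorModule.

(* The A-C-bimodule M (x)_B N. *)
Section TensorBimodule.
Variables (k : fieldType) (A B C : falgType k).
Variables (M : lmodType (envalg A B)) (N : lmodType (envalg B C)).

Definition tensbimod : Type := tens (@ract k A B M) (@lact k B C N).
HB.instance Definition _ := GRing.Zmodule.on tensbimod.

Definition bpure (m : M) (n : N) : tensbimod := tpure _ _ m n.

Lemma bpureDl m m' n : bpure (m + m') n = bpure m n + bpure m' n.
Proof. exact: tpureDl. Qed.
Lemma bpureDr m n n' : bpure m (n + n') = bpure m n + bpure m n'.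
Proof. exact: tpureDr. Qed.
Lemma bpureM m b n : bpure (ract m b) n = bpure m (lact b n).
Proof. exact: (tpureM (@ract k A B M)). Qed.
Lemma bpurek (c : k) m n : bpure (lact c%:A m) n = bpure m (ract n c%:A).
Proof. by rewrite lactk bpureM lactk. Qed.

Definition tb_act (z : envalg A C) (t : tensbimod) : tensbimod :=
  tlift (fun a c => tlift (fun m n => bpure (lact a m) (ract n c)) t) z.

Lemma tb_balr a c : balanced (@ract k A B M) (@lact k B C N)
  (fun m n => bpure (lact a m) (ract n c)).
Proof.
split=> [m m' n|m n n'|m b n].
- by rewrite lactDr bpureDl.
- by rewrite ractDl bpureDr.
- by rewrite lract bpureM lract.
Qed.

Lemma tb_ball (t : tensbimod) :
  balanced (fun (a : A) (c : k) => c *: a) (fun (c : k) (b : C) => c *: b)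
    (fun a c => tlift (fun m n => bpure (lact a m) (ract n c)) t : tensbimod).
Proof.
apply: balanced_tlift => m n; split=> [a a' c|a c c'|a l c].
- by rewrite lactDl bpureDl.
- by rewrite ractDr bpureDr.
- have -> : l *: a = l%:A * a by rewrite -scalerAl mul1r.
  have -> : l *: c = c * l%:A by rewrite -scalerAr mulr1.
  by rewrite -lactA bpurek ractA.
Qed.

Lemma tensbimod_ind (P : tensbimod -> Prop) :
  P 0 -> (forall s t, P s -> P t -> P (s + t)) -> (forall m n, P (bpure m n)) ->
  forall t, P t.
Proof. exact: tens_ind. Qed.

Lemma tb_actE a c m n :
  tb_act (epure a c) (bpure m n) = bpure (lact a m) (ract n c).
Proof. by rewrite /tb_act (tliftE (tb_ball _)) (tliftE (tb_balr _ _)). Qed.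
Lemma tb_actDl t : {morph tb_act^~ t : z w / z + w}.
Proof. by move=> z w; apply: tliftD (tb_ball t) _ _. Qed.
Lemma tb_actDr : right_distributive tb_act +%R.
Proof.
move=> z s t; rewrite /tb_act -tlift_addf; apply: eq_tlift => a c.
exact: tliftD (tb_balr a c) _ _.
Qed.
Lemma tb_act0l t : tb_act 0 t = 0.
Proof. exact: tlift0 (tb_ball t). Qed.
Lemma tb_act0r z : tb_act z 0 = 0.
Proof. by apply: (addrI (tb_act z 0)); rewrite -tb_actDr !addr0. Qed.
Lemma tb_actA z w t : tb_act z (tb_act w t) = tb_act (z * w) t.
Proof.
elim/envalg_ind: z => [|z z' h h'|a c]; first by rewrite mul0r !tb_act0l.
  by rewrite mulrDl !tb_actDl h h'.
elim/envalg_ind: w => [|w w' h h'|a' c'].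
- by rewrite mulr0 !tb_act0l tb_act0r.
- by rewrite mulrDr !tb_actDl tb_actDr h h'.
elim/tensbimod_ind: t => [|t t' h h'|m n]; first by rewrite !tb_act0r.
  by rewrite !tb_actDr h h'.
by rewrite epureM !tb_actE lactA ractA.
Qed.
Lemma tb_act1 : left_id 1 tb_act.
Proof.
elim/tensbimod_ind=> [|t t' h h'|m n]; first by rewrite tb_act0r.
  by rewrite tb_actDr h h'.
by rewrite tb_actE lact1 ract1.
Qed.

HB.instance Definition _ := GRing.Zmodule_isLmodule.Build (envalg A C) tensbimod
  tb_actA tb_act1 tb_actDr tb_actDl.

End TensorBimodule.

(** Hom-sets carry an equivalence relation [heq], and two morphisms are regarded
    as equal when they are related by it; thus a quotient category is obtained
    by enlarging [heq] rather than by taking quotients of the hom-sets. *)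

Record category := Category {
  ob :> Type;
  mor : ob -> ob -> Type;
  heq : forall X Y, mor X Y -> mor X Y -> Prop;
  idm : forall X, mor X X;
  mcomp : forall X Y Z, mor Y Z -> mor X Y -> mor X Z;
  heq_refl : forall X Y (f : mor X Y), heq f f;
  heq_sym : forall X Y (f g : mor X Y), heq f g -> heq g f;
  heq_trans : forall X Y (f g h : mor X Y), heq f g -> heq g h -> heq f h;
  comp_heq : forall X Y Z (f f' : mor Y Z) (g g' : mor X Y),
    heq f f' -> heq g g' -> heq (mcomp f g) (mcomp f' g');
  compA : forall X Y Z W (f : mor Z W) (g : mor Y Z) (h : mor X Y),
    heq (mcomp f (mcomp g h)) (mcomp (mcomp f g) h);
  compIm : forall X Y (f : mor X Y), heq (mcomp (idm Y) f) f;
  compmI : forall X Y (f : mor X Y), heq (mcomp f (idm X)) f }.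

Arguments mor {c}.
Arguments heq {c X Y}.
Arguments idm {c}.
Arguments mcomp {c X Y Z}.

Record functor (C D : category) := Functor {
  fob :> C -> D;
  fmap : forall X Y : C, mor X Y -> mor (fob X) (fob Y);
  fmap_heq : forall (X Y : C) (f g : mor X Y), heq f g -> heq (fmap f) (fmap g);
  fmap_id : forall X : C, heq (fmap (idm X)) (idm (fob X));
  fmap_comp : forall (X Y Z : C) (f : mor Y Z) (g : mor X Y),
    heq (fmap (mcomp f g)) (mcomp (fmap f) (fmap g)) }.

Arguments fmap {C D} _ {X Y}.

Definition nat_iso (C D : category) (F G : functor C D) : Prop :=
  exists (t : forall X : C, mor (F X) (G X)) (s : forall X : C, mor (G X) (F X)),
    [/\ forall X, heq (mcomp (s X) (t X)) (idm (F X)),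
        forall X, heq (mcomp (t X) (s X)) (idm (G X))
      & forall (X Y : C) (f : mor X Y),
          heq (mcomp (t Y) (fmap F f)) (mcomp (fmap G f) (t X))].

Definition functor_id (C : category) : functor C C :=
  @Functor C C id (fun X Y f => f) (fun X Y f g e => e)
    (fun X => heq_refl (idm X)) (fun X Y Z f g => heq_refl (mcomp f g)).

Section Composition.
Variables (C D E : category) (G : functor D E) (F : functor C D).
Definition functor_comp : functor C E.
Proof.
apply: (@Functor C E (fun X => G (F X)) (fun X Y f => fmap G (fmap F f))).
- by move=> X Y f g e; do 2!apply: fmap_heq.
- by move=> X; apply: heq_trans (fmap_id _ _); apply/fmap_heq/fmap_id.
- by move=> X Y Z f g; apply: heq_trans (fmap_comp _ _ _); apply/fmap_heq/fmap_comp.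
Defined.
End Composition.

Fixpoint functor_iter (C : category) (n : nat) (S : functor C C) : functor C C :=
  if n is m.+1 then functor_comp S (functor_iter m S) else functor_id C.

(* For a singular equivalence with level n, M (x)_B - and N (x)_A - compose to the
   autoequivalence Omega^n, so they are mutually quasi-inverse up to Omega^n (and
   on the nose only when n = 0, or when Omega^n happens to be the identity). *)
Definition quasi_inverse_up_to (C D : category)
    (S : functor C C) (T : functor D D) (F : functor C D) (G : functor D C) :=
  nat_iso (functor_comp G F) S /\ nat_iso (functor_comp F G) T.

Definition quasi_inverse (C D : category) (F : functor C D) (G : functor D C) :=
  quasi_inverse_up_to (functor_id C) (functor_id D) F G.

Definition is_equivalence (C D : category) (F : functor C D) : Prop :=
  exists G : functor D C, quasi_inverse F G.

Definition full_sub (C : category) (P : C -> Prop) : category :=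
  @Category {X : C | P X} (fun X Y => mor (sval X) (sval Y))
    (fun X Y => @heq C (sval X) (sval Y)) (fun X => idm (sval X))
    (fun X Y Z => @mcomp C (sval X) (sval Y) (sval Z))
    (fun X Y f => heq_refl f) (fun X Y f g => @heq_sym C _ _ f g)
    (fun X Y f g h => @heq_trans C _ _ f g h)
    (fun X Y Z f f' g g' => @comp_heq C _ _ _ f f' g g')
    (fun X Y Z W f g h => compA f g h)
    (fun X Y f => compIm f) (fun X Y f => compmI f).

Definition restrict (C D : category) (P : C -> Prop) (Q : D -> Prop)
    (F : functor C D) (hF : forall X : C, P X -> Q (F X)) :
  functor (full_sub P) (full_sub Q) :=
  @Functor (full_sub P) (full_sub Q)
    (fun X => exist Q (F (sval X)) (hF (sval X) (svalP X)))
    (fun X Y f => fmap F f) (fun X Y f g e => fmap_heq F e)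
    (fun X => fmap_id F (sval X)) (fun X Y Z f g => fmap_comp F f g).

Section Stable.
Variable R : pzRingType.
Implicit Types X Y Z P Q : lmodType R.

Lemma fin_genI X (I : finType) (g : I -> X) :
  (forall x, exists c : I -> R, x = \sum_i c i *: g i) -> fin_gen X.
Proof.
move=> h; exists #|I|, (fun i => g (enum_val i)) => x.
have [c ->] := h x; exists (fun i => c (enum_val i)).
by rewrite (reindex _ (onW_bij _ (@enum_val_bij I))).
Qed.

Lemma zero_fin_gen : fin_gen 'rV[R]_0.
Proof. by exists 0, (fun _ => 0) => x; exists (fun _ => 0); rewrite big_ord0 thinmx0. Qed.

Lemma zero_projective : projective 'rV[R]_0.
Proof. by move=> X Y p f _; exists \0 => x; rewrite thinmx0 !linear0. Qed.

Lemma prod_fin_gen P Q : fin_gen P -> fin_gen Q -> fin_gen (P * Q)%type.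
Proof.
move=> [m [g hg]] [n [h hh]].
apply: (@fin_genI _ ('I_m + 'I_n)%type
  (fun i => match i with inl i => (g i, 0) | inr j => (0, h j) end)).
case=> x y; have [c ->] := hg x; have [d ->] := hh y.
exists (fun i => match i with inl i => c i | inr j => d j end).
rewrite big_sumType /=.
have -> : \sum_i c i *: (g i, 0 : Q) = (\sum_i c i *: g i, 0).
  elim/big_rec2: _ => // i u v _ ->; congr pair => /=.
  by rewrite scaler0 add0r.
have -> : \sum_i d i *: (0 : P, h i) = (0, \sum_i d i *: h i).
  elim/big_rec2: _ => // i u v _ ->; congr pair => /=.
  by rewrite scaler0 add0r.
by congr pair; rewrite /= ?addr0 ?add0r.
Qed.

Lemma pair_linear X P Q (u : {linear X -> P}) (v : {linear X -> Q}) :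
  linear (fun x => (u x, v x)).
Proof. by move=> a x y; rewrite !linearP. Qed.
Lemma copair_linear P Q Y (u : {linear P -> Y}) (v : {linear Q -> Y}) :
  linear (fun x : P * Q => u x.1 + v x.2).
Proof. by move=> a x y; rewrite !linearP scalerDr addrACA. Qed.
Lemma inl_linear P Q : linear (fun x : P => (x, 0) : P * Q).
Proof. by move=> a x y; congr pair; rewrite /= scaler0 addr0. Qed.
Lemma inr_linear P Q : linear (fun x : Q => (0, x) : P * Q).
Proof. by move=> a x y; congr pair; rewrite /= scaler0 addr0. Qed.

Lemma prod_projective P Q :
  projective P -> projective Q -> projective (P * Q)%type.
Proof.
move=> hP hQ X Y p f hp.
have [g hg] := hP X Y p (f \o mklin (@inl_linear P Q)) hp.
have [h hh] := hQ X Y p (f \o mklin (@inr_linear P Q)) hp.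
exists (mklin (copair_linear g h)) => -[x y].
rewrite [in LHS]/= /lin_fun /= linearD hg hh /= -linearD /lin_fun.
by congr (f _); congr pair; rewrite /= ?addr0 ?add0r.
Qed.

Lemma stable_eq_ext X Y (f g : {linear X -> Y}) : f =1 g -> stable_eq f g.
Proof.
move=> e; exists 'rV[R]_0, \0, \0; split=> [||x].
- exact: zero_fin_gen.
- exact: zero_projective.
- by rewrite e subrr.
Qed.

Lemma stable_eq_refl X Y (f : {linear X -> Y}) : stable_eq f f.
Proof. exact: stable_eq_ext. Qed.

Lemma stable_eq_sym X Y (f g : {linear X -> Y}) : stable_eq f g -> stable_eq g f.
Proof.
move=> [P [u [v [fP pP h]]]]; exists P, u, (\- v); split=> // x.
by rewrite /= -h opprB.
Qed.

Lemma stable_eq_trans X Y (f g h : {linear X -> Y}) :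
  stable_eq f g -> stable_eq g h -> stable_eq f h.
Proof.
move=> [P [u [v [fP pP e]]]] [Q [u' [v' [fQ pQ e']]]].
exists (P * Q)%type, (mklin (pair_linear u u')), (mklin (copair_linear v v')).
split=> [||x]; first exact: prod_fin_gen.
- exact: prod_projective.
- by rewrite /= /lin_fun /= /lin_fun /= -e -e' addrA subrK.
Qed.

Lemma stable_eq_comp X Y Z (f f' : {linear Y -> Z}) (g g' : {linear X -> Y}) :
  stable_eq f f' -> stable_eq g g' -> stable_eq (f \o g) (f' \o g').
Proof.
move=> [P [u [v [fP pP e]]]] [Q [u' [v' [fQ pQ e']]]].
apply: (@stable_eq_trans _ _ _ (f' \o g)).
  by exists P, (u \o g), v; split=> // x; apply: e.
by exists Q, u', (f' \o v'); split=> // x; rewrite /= -linearB e'.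
Qed.

Record fgmod := FgMod { fgmod_mod :> lmodType R; fgmodP : fin_gen fgmod_mod }.

Definition stmod : category.
Proof.
refine (@Category fgmod (fun X Y : fgmod => {linear X -> Y})
  (fun (X Y : fgmod) f g => @stable_eq R X Y f g)
  (fun X : fgmod => (idfun : {linear X -> X}))
  (fun (X Y Z : fgmod) (f : {linear Y -> Z}) (g : {linear X -> Y}) =>
     (f \o g : {linear X -> Z})) _ _ _ _ _ _ _).
- by move=> X Y; apply: stable_eq_refl.
- by move=> X Y; apply: stable_eq_sym.
- by move=> X Y; apply: stable_eq_trans.
- by move=> X Y Z; apply: stable_eq_comp.
- by move=> X Y Z W f g h; apply: stable_eq_ext.
- by move=> X Y f; apply: stable_eq_ext.
- by move=> X Y f; apply: stable_eq_ext.
Defined.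

Definition stG : category :=
  full_sub (C := stmod) (fun X : fgmod => gorenstein_dim0 X).

Definition stG_mod (X : stG) : lmodType R := fgmod_mod (sval X).

(* [S] is the first syzygy functor on [stG]: on objects it is given by a choice
   of short exact sequences 0 -> S X -> P X -> X -> 0 with P X projective, and on
   morphisms by lifting to the P X.  Such a functor is unique up to natural
   isomorphism. *)
Definition is_syzygy_functor (S : functor stG stG) : Prop :=
  exists (P : stG -> lmodType R)
         (i : forall X : stG, {linear stG_mod (S X) -> P X})
         (p : forall X : stG, {linear P X -> stG_mod X}),
    (forall X : stG, [/\ fin_gen (P X), projective (P X) & short_exact (i X) (p X)]) /\
    forall (X Y : stG) (f : {linear stG_mod X -> stG_mod Y}),
      exists (h : {linear P X -> P Y})
             (f' : {linear stG_mod (S X) -> stG_mod (S Y)}),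
        [/\ forall y, p Y (h y) = f (p X y),
            forall z, i Y (f' z) = h (i X z)
          & stable_eq f' (fmap S (f : mor X Y))].

End Stable.

Section TensorFunctor.
Variables (k : fieldType) (A B : falgType k) (M : lmodType (envalg A B)).

Lemma tensmod_fin_gen (X : lmodType B) :
  fin_gen M -> fin_gen X -> fin_gen (tensmod M X).
Proof.
move=> [n [g hg]] [q [y hy]].
pose e := vbasis (fullv : {vspace B}).
pose G (i : 'I_n * 'I_(\dim (fullv : {vspace B})) * 'I_q) : tensmod M X :=
  mpure (ract (g i.1.1) e`_(i.1.2)) (y i.2).
apply: (@fin_genI _ _ _ G) => t.
pose Q t := exists c, t = \sum_i c i *: G i.
have Q0 : Q 0 by exists (fun _ => 0); rewrite big1 // => i _; apply: scale0r.
have QD s u : Q s -> Q u -> Q (s + u).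
  move=> [c ->] [d ->]; exists (fun i => c i + d i).
  by rewrite -big_split; apply: eq_bigr => i _; rewrite scalerDl.
have QZ a s : Q s -> Q (a *: s).
  move=> [c ->]; exists (fun i => a * c i).
  by rewrite scaler_sumr; apply: eq_bigr => i _; rewrite scalerA.
have mD (x : X) : {morph (fun m : M => mpure m x) : u v / u + v}.
  by move=> u v; apply: mpureDl.
have m0 (x : X) : mpure (0 : M) x = 0.
  by apply: (addrI (mpure (0 : M) x)); rewrite -mpureDl !addr0.
have Qe i b j : Q (mpure (ract (g i) b) (y j)).
  have -> : b = \sum_l coord e l b *: e`_l.
    by apply: coord_vbasis; rewrite memvf.
  pose h (b : B) := mpure (ract (g i) b) (y j) : tensmod M X.
  have hD : {morph h : u v / u + v} by move=> u v; rewrite /h ractDr mpureDl.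
  have h0 : h 0 = 0 by apply: (addrI (h 0)); rewrite -hD !addr0.
  rewrite -/(h _) (big_morph h hD h0); apply: (big_ind Q) => // l _; rewrite /h.
  have -> : coord e l b *: e`_l = e`_l * (coord e l b)%:A.
    by rewrite -scalerAr mulr1.
  rewrite -ractA -lactk -tensmod_scaleE; apply: QZ.
  exists (fun u => if u == (i, l, j) then 1 else 0).
  rewrite (bigD1 (i, l, j)) //= eqxx scale1r big1 ?addr0 // => u /negPf ->.
  exact: scale0r.
elim/tensmod_ind: t => // m x.
have [c ->] := hy x.
have mD' : {morph (fun x : X => mpure m x) : u v / u + v}.
  by move=> u v; apply: mpureDr.
have m0' : mpure m (0 : X) = 0.
  by apply: (addrI (mpure m (0 : X))); rewrite -mpureDr !addr0.
rewrite (big_morph (fun x : X => mpure m x) mD' m0').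
apply: (big_ind Q) => // j _; rewrite -mpureM.
have [z ->] := hg (ract m (c j)).
rewrite (big_morph (fun m : M => mpure m (y j)) (mD _) (m0 _)).
apply: (big_ind Q) => // i _.
elim/envalg_ind: (z i) => [|s u hs hu|a b].
- by rewrite scale0r m0.
- by rewrite scalerDl mpureDl; apply: QD.
- by rewrite epure_act -tensmod_scaleE; apply: QZ.
Qed.

Lemma tensmod_projective (P : lmodType B) : projective (lres M) ->
  fin_gen P -> projective P -> projective (tensmod M P).
Proof.
move=> pM [n [g hg]] pP X Y p f sp.
have pi_lin : linear (fun v : 'rV[B]_n => \sum_i v 0 i *: g i).
  move=> a u v; rewrite scaler_sumr -big_split; apply: eq_bigr => i _ /=.
  by rewrite !mxE scalerDl scalerA.
have [|s hs] := pP 'rV[B]_n P (mklin pi_lin) idfun.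
  move=> x; have [c ->] := hg x; exists (\row_i c i).
  by apply: eq_bigr => i _; rewrite mxE.
have f_lin i : linear (fun m : lres M => f (mpure (m : M) (g i))).
  move=> a u v; rewrite -linearP; congr (f _).
  by rewrite mpureDl tensmod_scaleE.
have /choice [h hh] i := pM X Y p (mklin (f_lin i)) sp.
pose b (m : M) (x : P) : X := \sum_i h i (ract m (s x 0 i) : lres M).
have hb : balanced (@ract k A B M) (fun (b : B) (x : P) => b *: x) b.
  split=> [m m' x|m x y|m c x].
  - rewrite -big_split; apply: eq_bigr => i _ /=.
    by rewrite ractDl; apply: linearD.
  - rewrite -big_split; apply: eq_bigr => i _ /=.
    by rewrite linearD mxE ractDr; apply: linearD.
  - by apply: eq_bigr => i _; rewrite linearZ mxE ractA.
have psi_lin : linear (fun t : tensmod M P => tlift b t).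
  move=> a t u; rewrite tliftD //; congr (_ + _).
  elim/tensmod_ind: t => [|t t' e e'|m x].
  - by rewrite scaler0 tlift0 // scaler0.
  - by rewrite scalerDr !tliftD // e e' scalerDr.
  - rewrite tensmod_scaleE !tliftE // /b scaler_sumr.
    by apply: eq_bigr => i _; rewrite -lract; apply: linearZ.
exists (mklin psi_lin); elim/tensmod_ind => [|t t' e e'|m x].
- by rewrite !linear0.
- by rewrite !linearD e e'.
have sE : x = \sum_i s x 0 i *: g i by rewrite -{1}[x](hs x).
rewrite /= /lin_fun tliftE // /b linear_sum [in RHS]sE.
have mD' : {morph (fun x : P => f (mpure m x)) : u v / u + v}.
  by move=> u v; rewrite mpureDr linearD.
have m0' : f (mpure m (0 : P)) = 0.
  by apply: (addrI (f (mpure m (0 : P)))); rewrite -mD' !addr0.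
rewrite (big_morph (fun x : P => f (mpure m x)) mD' m0'); apply: eq_bigr => i _.
by rewrite hh /= /lin_fun mpureM.
Qed.

Lemma tmap_stable (X Y : lmodType B) (f g : {linear X -> Y}) :
  fin_gen M -> projective (lres M) ->
  stable_eq f g -> stable_eq (tmap M f) (tmap M g).
Proof.
move=> fM pM [P [u [v [fP pP e]]]].
exists (tensmod M P), (tmap M u), (tmap M v); split.
- exact: tensmod_fin_gen.
- exact: tensmod_projective.
elim/tensmod_ind => [|t t' h h'|m x].
- by rewrite !tmap0 subrr.
- by rewrite !tmapD opprD addrACA h h'.
- rewrite !tmapE -e; apply: (addIr (mpure m (g x))).
  by rewrite -mpureDr !subrK.
Qed.

Definition tensor_functor (fM : fin_gen M) (pM : projective (lres M)) :
  functor (stmod B) (stmod A).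
Proof.
apply: (@Functor (stmod B) (stmod A)
  (fun X : fgmod B => FgMod (tensmod_fin_gen fM (fgmodP X)))
  (fun (X Y : fgmod B) (f : {linear X -> Y}) => tmap M f)).
- by move=> X Y f g; apply: tmap_stable.
- move=> X; apply: stable_eq_ext; elim/tensmod_ind => [|t t' h h'|m x].
  + by rewrite /= !tmap0.
  + by rewrite /= !tmapD; move: h h' => /= -> ->.
  + exact: tmapE.
- move=> X Y Z f g; apply: stable_eq_ext; elim/tensmod_ind => [|t t' h h'|m x].
  + by rewrite /= !tmap0.
  + by rewrite /= !tmapD; move: h h' => /= -> ->.
  + by rewrite /= !tmapE.
Defined.

End TensorFunctor.

(* [se_MN] and [se_NM] are isomorphisms in the stable categories of bimodules:
   M (x)_B N = Omega^n(A) over A^e and N (x)_A M = Omega^n(B) over B^e. *)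
Record singular_equivalence_with_level (k : fieldType) (A B : falgType k)
    (n : nat) (M : lmodType (envalg A B)) (N : lmodType (envalg B A)) : Prop :=
  SingularEquivalence {
    se_fgM : fin_gen M;
    se_fgN : fin_gen N;
    se_projM : projective (lres M);
    se_projM' : projective (rres M);
    se_projN : projective (lres N);
    se_projN' : projective (rres N);
    se_MN : is_syzygy n (regbimod A) (tensbimod M N);
    se_NM : is_syzygy n (regbimod B) (tensbimod N M) }.

(* Main.v *)
From HB Require Import structures.
From mathcomp Require Import all_boot all_order all_algebra all_field.
From mathcomp Require Import boolp.
From Stdlib Require Import Setoid Morphisms.
From mathcomp Require functions.
Require Import Defs.

(** Write G(R) for the class of modules of Gorenstein dimension zero over R
    and Omega for the syzygy.

    Everything rests on M (x)_B - and N (x)_A - preserving Gorenstein dimension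
    zero.  For this G(R) is described as the largest class of finitely generated
    modules whose members X all sit in two short exact sequences
    0 -> K -> P -> X -> 0 and 0 -> X -> Q -> X' -> 0 with P and Q projective,
    Q finitely generated, K and X' in the class, and such that every map K -> R
    extends to P.  That G(R) has these properties is [gorenstein_syzygy] and
    [gorenstein_cosyzygy]; that it contains every class having them is
    [class_gorenstein].  The modules M (x)_B X with X in G(B) form such a class:
    M is projective on both sides, so tensoring with it keeps the sequences exact
    and their middle terms projective, and by adjunction a map M (x)_B K -> A
    extends to M (x)_B P if and only if the associated map K -> Hom_A(M, A)
    extends to P.  The latter extension exists because Ext^1_B(X, W) = 0 for X in
    G(B) and W of finite projective dimension, by induction on that dimension
    ([gorenstein_extends_projdim], [tensor_gorenstein]).

    For the composites, take the projective bimodules in a resolution of A over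
    its enveloping algebra that leads to Omega^n(A).  The syzygies are projective
    as right modules, so - (x)_A X turns the resolution into an exact sequence of
    projective A-modules ending in X, and M (x)_B N = Omega^n(A) becomes a stable
    isomorphism M (x)_B (N (x)_A X) = Omega^n(X), natural in X because lifts of a
    map to syzygies are stably unique ([syz_chain_tensor], [tensor_level]).

    Finally Omega is fully faithful and essentially surjective on the stable
    category of G(R), since maps from a syzygy to a projective module extend and
    since every module in G(R) is a syzygy of another one
    ([syz_weak_equivalence]).  Both composites of the two tensor functors are
    therefore equivalences, and this forces each of the two functors to be one
    ([weak_equivalence_factor]). *)

Set Implicit Arguments.
Unset Strict Implicit.
Unset Printing Implicit Defensive.

Import GRing.Theory.
Local Open Scope ring_scope.
Local Open Scope quotient_scope.

(** * Linear maps, projective modules, submodules and quotients *)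

Section Factor.
Variable R : pzRingType.
Implicit Types X Y Z K P Q : lmodType R.

Lemma factor_inj K P Z (i : {linear K -> P}) (g : {linear Z -> P}) :
  injective i -> (forall z, exists k, i k = g z) ->
  exists c : {linear Z -> K}, forall z, i (c z) = g z.
Proof.
move=> injI /choice[c hc].
have c_lin : linear c by move=> a x y; apply: injI; rewrite linearP !hc linearP.
by exists (mklin c_lin).
Qed.

Lemma factor_surj P X Z (p : {linear P -> X}) (f : {linear P -> Z}) :
  surj p -> (forall y, p y = 0 -> f y = 0) ->
  exists g : {linear X -> Z}, forall y, g (p y) = f y.
Proof.
move=> /choice[s hs] kerf.
have fE y y' : p y = p y' -> f y = f y'.
  by move=> e; apply/subr0_eq; rewrite -linearB kerf // linearB e subrr.
have g_lin : linear (fun x => f (s x)).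
  by move=> a x y; rewrite -linearP; apply: fE; rewrite linearP !hs.
by exists (mklin g_lin) => y; apply: fE; rewrite hs.
Qed.

Lemma short_exact_comp0 K P X (i : {linear K -> P}) (p : {linear P -> X}) :
  short_exact i p -> forall z, p (i z) = 0.
Proof. by move=> [_ _ e] z; apply/e; exists z. Qed.

Lemma short_exact_factor K P X Z (i : {linear K -> P}) (p : {linear P -> X})
    (g : {linear Z -> P}) :
  short_exact i p -> (forall z, p (g z) = 0) ->
  exists c : {linear Z -> K}, forall z, i (c z) = g z.
Proof. by move=> [inj _ e] g0; apply: factor_inj => // z; apply/e. Qed.

Lemma comb_linear n X (g : 'I_n -> X) :
  linear (fun v : 'rV[R]_n => \sum_i v 0 i *: g i).
Proof.
move=> a u v; rewrite scaler_sumr -big_split; apply: eq_bigr => i _ /=.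
by rewrite !mxE scalerDl scalerA.
Qed.
Definition comb n X (g : 'I_n -> X) : {linear 'rV[R]_n -> X} :=
  mklin (comb_linear g).

Lemma combE n X (g : 'I_n -> X) v : comb g v = \sum_i v 0 i *: g i.
Proof. by []. Qed.

Lemma rV_projective n : projective 'rV[R]_n.
Proof.
move=> X Y p f /choice[s hs].
exists (comb (fun i => s (f (\row_j (i == j)%:R)))) => v.
rewrite combE linear_sum /=.
under eq_bigr do rewrite linearZ hs -linearZ.
rewrite -linear_sum; congr (f _); apply/rowP => j.
rewrite summxE (bigD1 j) //= big1 => [|i /negPf ij]; last first.
  by rewrite !mxE ij mulr0.
by rewrite !mxE eqxx mulr1 addr0.
Qed.

Lemma fin_gen_surj P X (p : {linear P -> X}) : surj p -> fin_gen P -> fin_gen X.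
Proof.
move=> sp [n [g hg]]; exists n, (p \o g) => x; have [y <-] := sp x.
have [c ->] := hg y; exists c; rewrite linear_sum.
by apply: eq_bigr => i _; rewrite linearZ.
Qed.

Lemma fin_gen_cover X :
  fin_gen X -> exists n (p : {linear 'rV[R]_n -> X}), surj p.
Proof.
move=> [n [g hg]]; exists n, (comb g) => x; have [c ->] := hg x.
by exists (\row_i c i); rewrite combE; apply: eq_bigr => i _; rewrite mxE.
Qed.

Lemma rV_fin_gen n : fin_gen 'rV[R]_n.
Proof.
exists n, (fun i => \row_j (i == j)%:R) => v; exists (fun i => v 0 i).
apply/rowP => j; rewrite summxE (bigD1 j) //= big1 => [|i /negPf ij].
  by rewrite !mxE eqxx mulr1 addr0.
by rewrite !mxE ij mulr0.
Qed.

Lemma entry_linear n (i : 'I_n) : linear (fun v : 'rV[R]_n => v 0 i : R^o).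
Proof. by move=> a u v; rewrite !mxE. Qed.

(** Splitting a free cover of P. Statements on finitely generated projectives are
    reduced to these coordinates, since they turn functors of P into finite sums. *)
Lemma dual_basis P : fin_gen P -> projective P ->
  exists n (g : 'I_n -> P) (s : 'I_n -> {linear P -> R^o}),
    forall x, x = \sum_i (s i x : R) *: g i.
Proof.
move=> [n [g hg]] pP.
have [|s hs] := pP _ _ (comb g) idfun.
  move=> x; have [c ->] := hg x; exists (\row_i c i).
  by rewrite combE; apply: eq_bigr => i _; rewrite mxE.
exists n, g, (fun i => mklin (@entry_linear n i) \o s) => x.
by rewrite -{1}[x]hs.
Qed.

Lemma projective_retract P Q (f : {linear P -> Q}) (g : {linear Q -> P}) :
  (forall x, g (f x) = x) -> projective Q -> projective P.
Proof.
move=> gf pQ X Y p h sp; have [l hl] := pQ X Y p (h \o g) sp.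
by exists (l \o f) => x; rewrite /= hl /= gf.
Qed.

End Factor.

Section Submodule.
Variables (R : pzRingType) (V : lmodType R).

(** Submodules are predicates in Prop, so that kernels and images are instances
    whatever the ring. *)
Record submodule := Submodule {
  in_sub :> V -> Prop;
  in_sub0 : in_sub 0;
  in_subP : forall a x y, in_sub x -> in_sub y -> in_sub (a *: x + y) }.

Variable S : submodule.

Definition sub_pred : {pred V} := fun x => `[< S x >].

Lemma sub_pred_closed : submod_closed sub_pred.
Proof.
split=> [|a x y]; first by apply/asboolP/in_sub0.
by move=> /asboolP Sx /asboolP Sy; apply/asboolP/in_subP.
Qed.
HB.instance Definition _ := GRing.isSubmodClosed.Build R V sub_pred sub_pred_closed.

Definition sub_mod : Type := {x : V | sub_pred x}.
HB.instance Definition _ := SubChoice.on sub_mod.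
HB.instance Definition _ := [SubChoice_isSubLmodule of sub_mod by <:].

Definition sub_incl : {linear sub_mod -> V} := (val : sub_mod -> V).

Lemma sub_incl_inj : injective sub_incl.
Proof. exact: val_inj. Qed.

Lemma sub_incl_in (z : sub_mod) : S (sub_incl z).
Proof. by apply/asboolP; apply: (valP z). Qed.

Lemma sub_inclP x : S x -> exists z, sub_incl z = x.
Proof. by move=> /asboolP Sx; exists (exist _ x Sx). Qed.

Definition quot_rel (x y : V) : bool := `[< S (x - y) >].

Lemma in_subN x : S x -> S (- x).
Proof. by move=> Sx; rewrite -[- x]addr0 -scaleN1r; apply: in_subP => //; apply: in_sub0. Qed.
Lemma in_subD x y : S x -> S y -> S (x + y).
Proof. by move=> Sx Sy; rewrite -[x]scale1r; apply: in_subP. Qed.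
Lemma in_subZ a x : S x -> S (a *: x).
Proof. by move=> Sx; rewrite -[_ *: _]addr0; apply: in_subP => //; apply: in_sub0. Qed.

Lemma quot_rel_equiv : equiv_class_of quot_rel.
Proof.
split=> [x|x y|y x z].
- by apply/asboolP; rewrite subrr; apply: in_sub0.
- by apply/asboolP/asboolP => /in_subN; rewrite opprB.
- move=> /asboolP h /asboolP h'; apply/asboolP.
  by rewrite -(subrK y x) -addrA; apply: in_subD.
Qed.
Canonical quot_equiv : equiv_rel V := EquivRelPack quot_rel_equiv.

Definition quot_mod : Type := {eq_quot quot_equiv}.
HB.instance Definition _ := Choice.on quot_mod.

Definition qclass (x : V) : quot_mod := \pi_{eq_quot quot_equiv} x.
Definition qrepr (q : quot_mod) : V := repr (q : {eq_quot quot_equiv}).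

Lemma qclassP x y : qclass x = qclass y <-> S (x - y).
Proof.
split=> [/eqmodP/asboolP //|h]; apply/eqmodP; exact/asboolP.
Qed.
Lemma qreprK : cancel qrepr qclass.
Proof. exact: reprK. Qed.
Lemma qrepr_class x : S (qrepr (qclass x) - x).
Proof. by apply/qclassP; rewrite qreprK. Qed.

Definition qzero := qclass 0.
Definition qadd a b := qclass (qrepr a + qrepr b).
Definition qopp a := qclass (- qrepr a).
Definition qscale c a := qclass (c *: qrepr a).

Lemma qaddE x y : qadd (qclass x) (qclass y) = qclass (x + y).
Proof.
by apply/qclassP; rewrite opprD addrACA; apply: in_subD; apply: qrepr_class.
Qed.
Lemma qoppE x : qopp (qclass x) = qclass (- x).
Proof.
by apply/qclassP; rewrite -opprD; apply/in_subN/qrepr_class.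
Qed.
Lemma qscaleE c x : qscale c (qclass x) = qclass (c *: x).
Proof. by apply/qclassP; rewrite -scalerBr; apply/in_subZ/qrepr_class. Qed.

Lemma quot_ind (Q : quot_mod -> Prop) : (forall x, Q (qclass x)) -> forall q, Q q.
Proof. by move=> h q; rewrite -[q]qreprK. Qed.

Lemma qaddA : associative qadd.
Proof. by do 3!elim/quot_ind=> ?; rewrite !qaddE addrA. Qed.
Lemma qaddC : commutative qadd.
Proof. by do 2!elim/quot_ind=> ?; rewrite !qaddE addrC. Qed.
Lemma qadd0 : left_id qzero qadd.
Proof. by elim/quot_ind=> ?; rewrite !qaddE add0r. Qed.
Lemma qaddN : left_inverse qzero qopp qadd.
Proof. by elim/quot_ind=> ?; rewrite qoppE !qaddE addNr. Qed.
HB.instance Definition _ := GRing.isZmodule.Build quot_mod qaddA qaddC qadd0 qaddN.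

Lemma qscaleA a b q : qscale a (qscale b q) = qscale (a * b) q.
Proof. by elim/quot_ind: q => x; rewrite !qscaleE scalerA. Qed.
Lemma qscale1 : left_id 1 qscale.
Proof. by elim/quot_ind=> x; rewrite !qscaleE scale1r. Qed.
Lemma qscaleDr : right_distributive qscale +%R.
Proof.
move=> a; do 2!elim/quot_ind=> ?.
by rewrite /GRing.add /= qaddE !qscaleE qaddE scalerDr.
Qed.
Lemma qscaleDl q : {morph qscale^~ q : a b / a + b}.
Proof.
elim/quot_ind: q => x a b.
by rewrite [RHS]/GRing.add /= !qscaleE qaddE scalerDl.
Qed.
HB.instance Definition _ := GRing.Zmodule_isLmodule.Build R quot_mod
  qscaleA qscale1 qscaleDr qscaleDl.

Lemma qclass_linear : linear qclass.
Proof. by move=> a x y; rewrite /GRing.scale /GRing.add /= qscaleE qaddE. Qed.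
Definition quot_proj : {linear V -> quot_mod} := mklin qclass_linear.

Lemma quot_proj_surj : surj quot_proj.
Proof. by move=> q; exists (qrepr q); apply: qreprK. Qed.

Lemma quot_proj0 x : quot_proj x = 0 <-> S x.
Proof. by rewrite -(subr0 (x)) -(qclassP x 0) subr0. Qed.

End Submodule.

Section KerCoker.
Variables (R : pzRingType).
Implicit Types X P : lmodType R.

Lemma kerP X P (p : {linear P -> X}) a x y :
  p x = 0 -> p y = 0 -> p (a *: x + y) = 0.
Proof. by move=> e e'; rewrite linearP e e' scaler0 addr0. Qed.
Definition ker_sub X P (p : {linear P -> X}) : submodule P :=
  Submodule (linear0 p) (@kerP X P p).

Lemma short_exact_ker X P (p : {linear P -> X}) :
  surj p -> short_exact (sub_incl (ker_sub p)) p.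
Proof.
split=> //; first exact: sub_incl_inj.
move=> y; split=> [|[z <-]]; first exact: (@sub_inclP _ _ (ker_sub p)).
exact: (sub_incl_in (S := ker_sub p)).
Qed.

Lemma im_sub0 X P (i : {linear X -> P}) : exists z, i z = 0.
Proof. by exists 0; rewrite linear0. Qed.
Lemma im_subP X P (i : {linear X -> P}) a x y :
  (exists z, i z = x) -> (exists z, i z = y) -> exists z, i z = a *: x + y.
Proof. by move=> [u <-] [v <-]; exists (a *: u + v); rewrite linearP. Qed.
Definition im_sub X P (i : {linear X -> P}) : submodule P :=
  Submodule (im_sub0 i) (@im_subP X P i).

Lemma short_exact_coker X P (i : {linear X -> P}) :
  injective i -> short_exact i (quot_proj (im_sub i)).
Proof.
split=> //; first exact: quot_proj_surj.
by move=> y; apply: (quot_proj0 (im_sub i)).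
Qed.
End KerCoker.

(** * Finite dimensional algebras are noetherian on both sides *)

Section VectorSpaces.
Variable k : fieldType.
Implicit Types V W K : lmodType k.

(** A generating family of least size is linearly independent, as a nontrivial
    relation would make one of its members redundant; so the coefficients of a
    vector are unique, hence linear in it. *)
Lemma fin_gen_coord V : fin_gen V ->
  exists d (g : 'I_d -> V) (c : {linear V -> 'rV[k]_d}),
    forall x, x = \sum_i c x 0 i *: g i.
Proof.
move=> [n hn].
pose gen d := `[< exists g : 'I_d -> V, forall x, exists c : 'I_d -> k, x = \sum_i c i *: g i >].
have exgen : exists d, gen d by exists n; apply/asboolP.
case: (ex_minnP exgen) => -[|d] /asboolP[g hg] min.
  exists 0, g, \0 => x; have [c ->] := hg x; by rewrite !big_ord0.
have indep (c : 'I_d.+1 -> k) : \sum_i c i *: g i = 0 -> forall j, c j = 0.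
  move=> c0 j; apply/eqP/negPn/negP => cj.
  suff: (d.+1 <= d)%N by rewrite ltnn.
  apply: min; apply/asboolP; exists (fun l => g (lift j l)) => x.
  have [b ->] := hg x.
  (* substitute the expression of g j given by the relation *)
  exists (fun l => b (lift j l) - b j / c j * c (lift j l)).
  have gj : g j = - \sum_l (c (lift j l) / c j) *: g (lift j l).
    apply: (scalerI cj); apply/subr0_eq; rewrite -[RHS]c0 (bigD1_ord j) //=.
    congr (_ + _); rewrite scalerN opprK scaler_sumr; apply: eq_bigr => l _.
    by rewrite scalerA mulrCA mulfV // mulr1.
  rewrite (bigD1_ord j) //= gj scalerN scaler_sumr -sumrN -big_split.
  apply: eq_bigr => l _ /=; rewrite scalerA addrC -scalerBl; congr ((_ - _) *: _).
  by rewrite -!mulrA (mulrC (c _)).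
have /choice[c hc] := hg.
have c_lin : linear (fun x => \row_i c x i).
  move=> a x y; apply/rowP => j; rewrite !mxE; apply/subr0_eq.
  apply: (indep (fun i => c (a *: x + y) i - (a * c x i + c y i))).
  under eq_bigr do rewrite scalerBl scalerDl -scalerA.
  by rewrite sumrB big_split /= -scaler_sumr -!hc subrr.
exists d.+1, g, (mklin c_lin) => x; rewrite {1}[x]hc.
by apply: eq_bigr => i _; rewrite mxE.
Qed.

Lemma fin_gen_projective V : fin_gen V -> projective V.
Proof.
move=> /fin_gen_coord[d [g [c hc]]].
by apply: (@projective_retract _ _ _ c (comb g)) (@rV_projective _ _) => x; rewrite combE -hc.
Qed.

(** Sequences of K with free image in k^d have bounded length, and a longest one
    spans. *)
Lemma field_noetherian K V (j : {linear K -> V}) :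
  injective j -> fin_gen V -> fin_gen K.
Proof.
move=> injj /fin_gen_coord[d [g [c hc]]].
pose h : {linear K -> 'rV[k]_d} := c \o j.
have injh : injective h.
  by move=> x y /= e; apply: injj; rewrite [LHS]hc [RHS]hc /= e.
pose P r := `[< exists s : seq K, free (map h s) /\ size s = r >].
have exP : exists r, P r by exists 0; apply/asboolP; exists [::]; rewrite nil_free.
have boundP r : P r -> (r <= d)%N.
  move=> /asboolP[s [fs <-]]; rewrite -(size_map h) -(eqP fs).
  by apply: leq_trans (dimvS (subvf _)) _; rewrite dimvf dim_matrix mul1r.
case: (ex_maxnP exP boundP) => r /asboolP[s [fs sr]] max.
exists (size s), (fun i => s`_i) => x.
have hx : h x \in <<map h s>>%VS.
  apply/negPn/negP => hx; suff: (r.+1 <= r)%N by rewrite ltnn.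
  apply: max; apply/asboolP; exists (x :: s); rewrite /= free_cons hx sr.
  by split.
move: hx; rewrite -[map h s]/(val (map_tuple h (in_tuple s))) => hx.
exists (fun i => coord (map_tuple h (in_tuple s)) i (h x)); apply: injh.
rewrite {1}(coord_span hx) linear_sum; apply: eq_bigr => i _.
by rewrite linearZ (nth_map 0).
Qed.

End VectorSpaces.

Section Restriction.
Variables (k R : pzRingType).

(** The ring morphism is an argument of the type because the action of k depends
    on it. *)
Definition kmod of {rmorphism k -> R} := fun X : lmodType R => X : Type.

Variables (phi : {rmorphism k -> R}) (X : lmodType R).
Local Notation kX := (kmod phi X).
HB.instance Definition _ := GRing.Zmodule.on kX.
Definition kact (c : k) (x : kX) : kX := phi c *: (x : X).
Lemma kactA a b x : kact a (kact b x) = kact (a * b) x.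
Proof. by rewrite /kact scalerA rmorphM. Qed.
Lemma kact1 : left_id 1 kact.
Proof. by move=> x; rewrite /kact rmorph1 scale1r. Qed.
Lemma kactDr : right_distributive kact +%R.
Proof. by move=> c x y; apply: scalerDr. Qed.
Lemma kactDl x : {morph kact^~ x : a b / a + b}.
Proof. by move=> a b; rewrite /kact rmorphD scalerDl. Qed.
HB.instance Definition _ := GRing.Zmodule_isLmodule.Build k kX
  kactA kact1 kactDr kactDl.

Lemma kmodZ (c : k) (x : kX) : c *: x = phi c *: (x : X).
Proof. by []. Qed.

End Restriction.

(** Stated with injections rather than submodules, so that it applies directly to
    the first term of a short exact sequence. *)
Definition noetherian (R : pzRingType) : Prop :=
  forall (K P : lmodType R) (i : {linear K -> P}),
    injective i -> fin_gen P -> fin_gen K.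

Section FiniteOver.
Variables (k : fieldType) (R : pzRingType) (phi : {rmorphism k -> R}).
Variables (d : nat) (e : 'I_d -> R).
Hypothesis e_gen : forall r, exists c : 'I_d -> k, r = \sum_i phi (c i) * e i.

Lemma fin_gen_kmod (X : lmodType R) : fin_gen X -> fin_gen (kmod phi X).
Proof.
move=> [n [g hg]].
apply: (@fin_genI _ _ _ (fun u : 'I_n * 'I_d => e u.2 *: g u.1 : kmod phi X)) => x.
have [c {1}->] := hg x; have /choice[b hb] i := e_gen (c i).
exists (fun u => b u.1 u.2).
rewrite -(pair_bigA _ (fun i j => (b i j : k) *: (e j *: g i : kmod phi X))) /=.
apply: eq_bigr => i _; rewrite [c i]hb scaler_suml; apply: eq_bigr => j _.
by rewrite -scalerA.
Qed.

(** Finitely generated modules are finite dimensional over k, and a k-basis of a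
    submodule generates it over R. *)
Lemma finite_noetherian : noetherian R.
Proof.
move=> K P i inji /fin_gen_kmod fP.
have i_lin : linear (i : kmod phi K -> kmod phi P).
  by move=> a x y; apply: (linearP i).
have [n [g hg]] := field_noetherian (j := mklin i_lin) inji fP.
exists n, g => x; have [c hc] := hg x; exists (fun i => phi (c i)); exact: hc.
Qed.

End FiniteOver.

Section FiniteDimensionalAlgebra.
Variables (k : fieldType) (A : falgType k).

(** Scalars are central, so they also act through the opposite algebra. *)
Definition alg_op (c : k) : A^c := c%:A.
Lemma alg_op_additive : zmod_morphism alg_op.
Proof. by move=> a b; rewrite /alg_op scalerBl. Qed.
Lemma alg_op_mult : monoid_morphism alg_op.
Proof.
split; first exact: scale1r.
move=> a b; have e : (a * b)%:A = b%:A * a%:A :> A.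
  by rewrite -scalerAl mul1r scalerA mulrC.
exact: e.
Qed.
HB.instance Definition _ := GRing.isZmodMorphism.Build k A^c alg_op alg_op_additive.
HB.instance Definition _ := GRing.isMonoidMorphism.Build k A^c alg_op alg_op_mult.

Definition alg_bas (i : 'I_(\dim (fullv : {vspace A}))) : A :=
  (vbasis (fullv : {vspace A}))`_i.

Lemma alg_basE (a : A) : a = \sum_i coord (vbasis fullv) i a *: alg_bas i.
Proof. by apply: coord_vbasis; rewrite memvf. Qed.

Lemma alg_gen (r : A) : exists c : 'I_(\dim (fullv : {vspace A})) -> k,
  r = \sum_i in_alg A (c i) * alg_bas i.
Proof.
exists (fun i => coord (vbasis fullv) i r); rewrite {1}[r]alg_basE.
by apply: eq_bigr => i _; rewrite in_algE -scalerAl mul1r.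
Qed.

Lemma alg_gen_op (r : A^c) : exists c : 'I_(\dim (fullv : {vspace A})) -> k,
  r = \sum_i alg_op (c i) * (alg_bas i : A^c).
Proof.
exists (fun i => coord (vbasis fullv) i (r : A)); rewrite {1}[r]alg_basE.
apply: eq_bigr => i _; rewrite [RHS](_ : _ = alg_bas i * (coord (vbasis fullv) i (r : A))%:A) //.
by rewrite -scalerAr mulr1.
Qed.

Lemma falg_noetherian : noetherian A.
Proof. exact: finite_noetherian alg_gen. Qed.
Lemma falg_op_noetherian : noetherian A^c.
Proof. exact: finite_noetherian alg_gen_op. Qed.

End FiniteDimensionalAlgebra.

(** * Vanishing of Ext *)

Section Ext.
Variable R : pzRingType.
Implicit Types X Y Z K P Q : lmodType R.

Definition extends K P Y (i : {linear K -> P}) : Prop :=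
  forall f : {linear K -> Y}, exists g : {linear P -> Y}, forall z, g (i z) = f z.

(** Ext^(j+1)(X, Y) = 0, unfolded by dimension shifting into the extension of
    maps from a (j+1)-st syzygy. The universal form, over all choices of
    syzygies, is the one to use; [ext_vanish_some], over one choice, is the one to
    prove; [ext_vanish_all] shows that they agree. *)
Fixpoint ext_vanish (j : nat) X Y : Prop :=
  forall K P (i : {linear K -> P}) (p : {linear P -> X}),
    projective P -> short_exact i p ->
    if j is j'.+1 then ext_vanish j' K Y else extends Y i.

Fixpoint ext_vanish_some (j : nat) X Y : Prop :=
  exists K P (i : {linear K -> P}) (p : {linear P -> X}),
    [/\ projective P, short_exact i p
      & if j is j'.+1 then ext_vanish_some j' K Y else extends Y i].

(** X is a retract of X' up to maps through a projective module. Retracts are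
    enough to transport the vanishing of Ext, and the projective module is not
    required to be finitely generated because resolutions need not be. *)
Definition proj_retract X X' : Prop :=
  exists (f : {linear X -> X'}) (g : {linear X' -> X}) (Q : lmodType R)
         (u : {linear X -> Q}) (v : {linear Q -> X}),
    projective Q /\ forall x, g (f x) - x = v (u x).

Lemma proj_retract_refl X : proj_retract X X.
Proof.
exists idfun, idfun, 'rV[R]_0, \0, \0; split; first exact: rV_projective.
by move=> x; rewrite /= subrr.
Qed.

(** Comparison of presentations: the lifts h and h' of f and g compose to the
    identity of P up to a map through the projective module and a map c into K,
    and the former vanishes on K. *)
Lemma proj_retract_syzygy X X' K P K' P' (i : {linear K -> P})
    (p : {linear P -> X}) (i' : {linear K' -> P'}) (p' : {linear P' -> X'}) :
  proj_retract X X' -> projective P -> projective P' ->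
  short_exact i p -> short_exact i' p' ->
  exists (h : {linear P -> P'}) (a : {linear K -> K'}) (a' : {linear K' -> K})
         (c : {linear P -> K}),
    (forall z, i' (a z) = h (i z)) /\ forall z, a' (a z) - z = c (i z).
Proof.
move=> [f [g [Q [u [v [pQ gf]]]]]] pP pP' se se'.
have [inji sp ex] := se; have [inji' sp' ex'] := se'.
have [h hh] := pP _ _ p' (f \o p) sp'.
have [h' hh'] := pP' _ _ p (g \o p') sp.
have [w hw] := pQ _ _ p v sp.
have [z|a ha] := short_exact_factor (g := h \o i) se'.
  by rewrite /= hh /= (short_exact_comp0 se) linear0.
have [z|a' ha'] := short_exact_factor (g := h' \o i') se.
  by rewrite /= hh' /= (short_exact_comp0 se') linear0.
have [y|c hc] := short_exact_factor (g := ((h' \o h) \- idfun) \- ((w \o u) \o p)) se.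
  by rewrite /= !linearB hh' /= hh /= hw -gf subrr.
exists h, a, a', c; split=> // z; apply: inji.
by rewrite hc linearB ha' /= ha (short_exact_comp0 se) !linear0 addr0.
Qed.

(** With a' a - 1 = c i on K, a map f on K is f a' a - f c i; the first term
    extends through P' and the second is already defined on P. *)
Lemma ext_vanish_retract j X X' Y :
  ext_vanish_some j X' Y -> proj_retract X X' -> ext_vanish j X Y.
Proof.
elim: j X X' => [|j IHj] X X' [K' [P' [i' [p' [pP' se' h']]]]] r K P i p pP se;
  have [h [a [a' [c [ha hc]]]]] := proj_retract_syzygy r pP pP' se se'.
  move=> f; have [G hG] := h' (f \o a').
  exists ((G \o h) \- (f \o c)) => z /=.
  by rewrite -ha hG /= -hc linearB opprB addrC subrK.
by apply: IHj h' _; exists a, a', P, i, c.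
Qed.

Lemma ext_vanish_all j X Y : ext_vanish_some j X Y -> ext_vanish j X Y.
Proof. by move=> /ext_vanish_retract; apply; apply: proj_retract_refl. Qed.

Lemma ext_vanish_shift X Y K P (i : {linear K -> P}) (p : {linear P -> X}) :
  projective P -> short_exact i p -> extends Y i ->
  (forall j, ext_vanish_some j K Y) -> forall j, ext_vanish j X Y.
Proof.
by move=> pP se ex eK [|j]; apply: ext_vanish_all; exists K, P, i, p.
Qed.

(** The image of d_j is a (j+1)-st syzygy, and a map on res_ob (j+1) that
    vanishes on the image of d_(j+1) is a map on that syzygy. *)
Lemma ExtS_zero_vanish_some j X Y : ExtS_zero j X Y -> ext_vanish_some j X Y.
Proof.
move=> [P hP].
elim: j X P hP => [|j IHj] X [P d e pP se e0 ed] /= hP;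
  exists (sub_mod (ker_sub e)), (P 0), (sub_incl (ker_sub e)), e;
  (split; [exact: pP | exact: short_exact_ker |]).
all: have [z|dl hdl] := short_exact_factor (g := d 0) (short_exact_ker se).
all: try by apply/e0; exists z.
all: have inj := @sub_incl_inj _ _ (ker_sub e).
  move=> f; have [z|g hg] := hP (f \o dl).
    rewrite /= (_ : dl (d 1 z) = 0) ?linear0 //; apply: inj.
    by rewrite hdl linear0; apply/ed; exists z.
  exists g => z; have /e0[y hy] := sub_incl_in z.
  by rewrite -hy -hg /=; congr (f _); apply: inj; rewrite hdl.
have sdl : surj dl.
  move=> z; have /e0[y hy] := sub_incl_in z; exists y.
  by apply: inj; rewrite hdl.
have dl0 y : dl y = 0 <-> exists z, d 1 z = y.
  split=> [e'|/ed e']; first by apply/ed; rewrite -hdl e' linear0.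
  by apply: inj; rewrite hdl e' linear0.
apply: (IHj _ (@ProjResolution _ _ (P \o succn) (fun i => d i.+1) dl
  (fun i => pP i.+1) sdl dl0 (fun i => ed i.+1))).
exact: hP.
Qed.

Lemma ext_pos_vanish j X Y : Ext_pos_zero X Y -> ext_vanish j X Y.
Proof. by move=> h; apply/ext_vanish_all/ExtS_zero_vanish_some/h. Qed.

Record cover X := Cover {
  cov_K : lmodType R;
  cov_P : lmodType R;
  cov_i : {linear cov_K -> cov_P};
  cov_p : {linear cov_P -> X};
  cov_proj : projective cov_P;
  cov_exact : short_exact cov_i cov_p }.

Arguments cov_proj [X] c : rename.
Arguments cov_exact [X] c : rename.

(** Choosing a presentation inside the class again and again builds a projective
    resolution all of whose syzygies have the extension property. *)
Lemma ext_of_class (C : lmodType R -> Prop) Y :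
  (forall X, C X -> exists c : cover X, C (cov_K c) /\ extends Y (cov_i c)) ->
  forall X, C X -> Ext_pos_zero X Y.
Proof.
move=> hC X0 CX0 j.
pose c (x : {X | C X}) := projT1 (cid (hC (sval x) (svalP x))).
have cC (x : {X | C X}) : C (cov_K (c x)).
  by rewrite /c; case: cid => /= ? [].
have cE (x : {X | C X}) : extends Y (cov_i (c x)).
  by rewrite /c; case: cid => /= ? [].
pose x (m : nat) : {X | C X} :=
  iter m (fun x => exist _ (cov_K (c x)) (cC x)) (exist _ X0 CX0).
pose d m : {linear cov_P (c (x m.+1)) -> cov_P (c (x m))} :=
  cov_i (c (x m)) \o (cov_p (c (x m.+1)) : {linear _ -> cov_K (c (x m))}).
have d0 m y : d m y = 0 <-> exists z, d m.+1 z = y.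
  have [inj _ _] := cov_exact (c (x m)).
  have [_ _ ex] := cov_exact (c (x m.+1)).
  have [_ sp _] := cov_exact (c (x m.+2)).
  split=> [e|[z <-]].
    have /ex[k <-] : cov_p (c (x m.+1)) y = 0 by apply: inj; rewrite linear0 -e.
    by have [z hz] := sp k; exists z; rewrite /= hz.
  rewrite /d /=; have -> : cov_p (c (x m.+1)) (cov_i (c (x m.+1)) (cov_p (c (x m.+2)) z)) = 0.
    exact: short_exact_comp0 (cov_exact (c (x m.+1))) _.
  exact: linear0.
have [_ se ex] := cov_exact (c (x 0)); have [_ se1 _] := cov_exact (c (x 1)).
have e0 y : cov_p (c (x 0)) y = 0 <-> exists z, d 0 z = y.
  split=> [/ex[k <-]|[z <-]]; first by have [z hz] := se1 k; exists z; rewrite /= hz.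
  by apply/ex; exists (cov_p (c (x 1)) z).
exists (ProjResolution (fun m => cov_proj (c (x m))) se e0 d0) => f /= f0.
have [_ sp ex1] := cov_exact (c (x j.+1)).
have [_ sp2 _] := cov_exact (c (x j.+2)).
have [y|f' hf'] := factor_surj (f := f) sp.
  move=> /ex1[k <-]; have [z hz] := sp2 k; rewrite -(f0 z) /= hz //.
have [g hg] := cE (x j) f'.
by exists g => y; rewrite -hf' -hg.
Qed.

Lemma fin_gen_cover_noetherian X : noetherian R -> fin_gen X ->
  exists c : cover X, fin_gen (cov_P c) /\ fin_gen (cov_K c).
Proof.
move=> nR /fin_gen_cover[m [p sp]].
exists (Cover (@rV_projective R m) (short_exact_ker sp)) => /=; split.
  exact: rV_fin_gen.
by apply: nR (@sub_incl_inj _ _ (ker_sub p)) _; apply: rV_fin_gen.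
Qed.

Lemma ext_vanish_pos X Y : noetherian R -> fin_gen X ->
  (forall j, ext_vanish j X Y) -> Ext_pos_zero X Y.
Proof.
move=> nR fX eX.
apply: (@ext_of_class (fun X => fin_gen X /\ forall j, ext_vanish j X Y)) => // {fX eX}X [fX eX].
have [c [_ fK]] := fin_gen_cover_noetherian nR fX; exists c.
have [pc sc] := (cov_proj c, cov_exact c).
split; last exact: (eX 0%N) pc sc.
by split=> // j; apply: (eX j.+1) pc sc.
Qed.

End Ext.
Arguments cov_proj [R X] c : rename.
Arguments cov_exact [R X] c : rename.

(** * Projective modules and duality *)

Section FreeCover.
Import functions.
Variables (R : pzRingType) (W : lmodType R).
Implicit Types (f : W -> R^o) (L : seq W).

Definition supported f L := forall w, w \notin L -> f w = 0.
Definition total f L : W := \sum_(w <- undup L) (f w : R) *: w.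

Lemma total_sub f L L' : {subset L <= L'} -> supported f L -> total f L' = total f L.
Proof.
move=> sub supp; rewrite /total (bigID (mem L)) /= [X in _ + X]big1 ?addr0.
  rewrite -big_filter; apply/perm_big/uniq_perm; rewrite ?filter_uniq ?undup_uniq //.
  move=> w; rewrite mem_filter !mem_undup /=.
  by case wL: (w \in L) => //=; apply: sub.
by move=> w wL; rewrite supp ?scale0r.
Qed.

(** The pairs (f, x) where f is finitely supported and x is the linear
    combination with coefficients f. These form the free module on the set W, and
    carrying x along makes the canonical map to W a projection. *)
Definition is_comb (u : (W -> R^o) * W) : Prop :=
  exists L, supported u.1 L /\ u.2 = total u.1 L.

Lemma is_comb0 : is_comb 0.
Proof. by exists [::]; split=> //; rewrite /total big_nil. Qed.

Lemma is_combP a u v : is_comb u -> is_comb v -> is_comb (a *: u + v).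
Proof.
move=> [L [s1 e1]] [L' [s2 e2]]; exists (L ++ L'); split=> [w|].
  rewrite mem_cat negb_or => /andP[wL wL'] /=.
  by rewrite /GRing.add /GRing.scale /= s1 // s2 // scaler0 addr0.
have sL : {subset L <= L ++ L'} by move=> w wL; rewrite mem_cat wL.
have sL' : {subset L' <= L ++ L'} by move=> w wL; rewrite mem_cat wL orbT.
rewrite /= e1 e2 -(total_sub sL) // -(total_sub sL') //.
rewrite /total scaler_sumr -big_split; apply: eq_bigr => w _ /=.
by rewrite scalerA -scalerDl.
Qed.

Definition combs : submodule ((W -> R^o) * W)%type := Submodule is_comb0 is_combP.

Lemma eval_comb_linear (w : W) : linear (fun z : sub_mod combs => (sub_incl combs z).1 w : R^o).
Proof. by move=> a x y; rewrite linearP. Qed.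
Lemma value_linear : linear (fun z : sub_mod combs => (sub_incl combs z).2).
Proof. by move=> a x y; rewrite linearP. Qed.

Lemma value_surj : Defs.surj (mklin value_linear).
Proof.
move=> w; have [|z hz] := @sub_inclP _ _ combs ((fun v => (v == w)%:R), w).
  exists [:: w]; split=> [v|]; first by rewrite inE /= => /negPf ->.
  by rewrite /total big_seq1 /= eqxx scale1r.
by exists z; rewrite /mklin /= /lin_fun; have := congr1 snd hz.
Qed.

Lemma row_linear K n (a : 'I_n -> {linear K -> R^o}) :
  linear (fun z : K => \row_i (a i z : R)).
Proof. by move=> c x y; apply/rowP => j; rewrite !mxE linearP. Qed.

(** A section s of the free cover of W sends f(K), which is finitely generated,
    to functions supported in one finite set. *)
Lemma projective_factor_free (K : lmodType R) (f : {linear K -> W}) :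
  projective W -> fin_gen K ->
  exists n (a : {linear K -> 'rV[R]_n}) (b : {linear 'rV[R]_n -> W}),
    forall z, b (a z) = f z.
Proof.
move=> pW [m [g hg]]; have [s hs] := pW _ _ _ idfun value_surj.
have /choice[l hl] i : exists L, supported (sub_incl combs (s (f (g i)))).1 L.
  by have [L [? _]] := sub_incl_in (s (f (g i))); exists L.
(* a finite set carrying s (f (g i)) for all i, hence s (f z) for all z *)
pose L := undup (flatten [seq l i | i <- enum 'I_m]).
have supp z : supported (sub_incl combs (s (f z))).1 L.
  move=> w wL; have [c ->] := hg z; rewrite !linear_sum.
  rewrite (big_morph (fun u : W -> R^o => u w) (id1 := 0) (op1 := +%R)) //.
  rewrite big1 // => i _; rewrite !linearZ /= {1}/GRing.scale /=.
  rewrite hl ?scaler0 //; apply: contra wL => wl; rewrite mem_undup.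
  by apply/flatten_mapP; exists i; rewrite ?mem_enum.
have fE z : f z = \sum_(w <- L) ((sub_incl combs (s (f z))).1 w : R) *: w.
  have [L0 [s0 e0]] := sub_incl_in (s (f z)).
  rewrite [LHS](_ : f z = total (sub_incl combs (s (f z))).1 L0); last first.
    by rewrite -e0; rewrite -[LHS]hs.
  have sub0 : {subset L0 <= L0 ++ L} by move=> w wL; rewrite mem_cat wL.
  have sub1 : {subset L <= L0 ++ L} by move=> w wL; rewrite mem_cat wL orbT.
  rewrite -(total_sub sub0 s0) (total_sub sub1 (supp z)).
  by rewrite /total undup_id ?undup_uniq.
exists (size L), (mklin (row_linear (fun i => mklin (eval_comb_linear L`_i) \o (s \o f)))).
exists (comb (fun i => L`_i)) => z.
rewrite combE [RHS]fE (big_nth 0) big_mkord; apply: eq_bigr => i _.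
by rewrite /mklin /= /lin_fun mxE.
Qed.

End FreeCover.

Section Duality.
Variable R : pzRingType.
Implicit Types X Y Z K P Q : lmodType R.

Lemma dualZ X (r : R^c) (f : dual X) x :
  hom_fun (r *: f) x = (hom_fun f x : R) * (r : R).
Proof. by []. Qed.
Lemma hom_funB X (xi : dual X) x y : hom_fun xi (x - y) = hom_fun xi x - hom_fun xi y.
Proof. exact: linearB. Qed.
Lemma dual_sum X (I : Type) (s : seq I) (F : I -> dual X) x :
  hom_fun (\sum_(i <- s) F i) x = \sum_(i <- s) hom_fun (F i) x.
Proof. by elim/big_rec2: _ => // i u v _ <-. Qed.

Definition dmap_fun X Y (f : {linear X -> Y}) (xi : dual Y) : dual X :=
  (xi : {linear Y -> R^o}) \o f.
Lemma dmap_linear X Y (f : {linear X -> Y}) : linear (dmap_fun f).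
Proof. by move=> a x y; apply: homP. Qed.
Definition dmap X Y (f : {linear X -> Y}) : {linear dual Y -> dual X} :=
  mklin (dmap_linear f).
Lemma dmapE X Y (f : {linear X -> Y}) (xi : dual Y) x :
  hom_fun (dmap f xi) x = hom_fun xi (f x).
Proof. by []. Qed.

(** The coordinate functions of a dual basis of P are generators of its dual, with
    the evaluations at the basis as coordinates. *)
Lemma dual_fin_gen_projective P : fin_gen P -> projective P ->
  fin_gen (dual P) /\ projective (dual P).
Proof.
move=> fP pP; have [n [g [s hs]]] := dual_basis fP pP.
have dE (xi : dual P) : xi = \sum_i (hom_fun xi (g i) : R^c) *: (s i : dual P).
  apply: homP => x; rewrite dual_sum /hom_fun {1}[x]hs linear_sum /=.
  by apply: eq_bigr => i _; rewrite linearZ.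
split; first by exists n, s => xi; exists (fun i => hom_fun xi (g i)); apply: dE.
move=> X Y p f /choice[t ht].
pose h (xi : dual P) : X := \sum_i (hom_fun xi (g i) : R^c) *: t (f (s i : dual P)).
have h_lin : linear h.
  move=> a u v; rewrite /h scaler_sumr -big_split; apply: eq_bigr => i _ /=.
  by rewrite scalerA -scalerDl.
exists (mklin h_lin) => xi; rewrite [in RHS](dE xi) !linear_sum.
by apply: eq_bigr => i _; rewrite !linearZ ht.
Qed.

Lemma dual_short_exact X K P (i : {linear K -> P}) (p : {linear P -> X}) :
  short_exact i p -> extends R^o i -> short_exact (dmap p) (dmap i).
Proof.
move=> se ex; have [inj sp e] := se; split=> [xi eta h|xi|xi].
- by apply: homP => x; have [y <-] := sp x; rewrite -!dmapE h.
- have [g hg] := ex xi; exists g; apply: homP => x; exact: hg.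
split=> [h|[eta <-]].
  have [y|g hg] := factor_surj (f := (xi : {linear P -> R^o})) sp.
    by move=> /e[z <-]; have := dmapE i xi z; rewrite h.
  by exists g; apply: homP => y; apply: hg.
by apply: homP => z; rewrite !dmapE (short_exact_comp0 se) /hom_fun !linear0.
Qed.

Definition reflexive_mod X : Prop :=
  (forall x : X, (forall xi : dual X, hom_fun xi x = 0) -> x = 0) /\
  forall phi : {linear dual X -> R^c^o}, exists x, forall xi, phi xi = hom_fun xi x.

(** The bidual is a module over the opposite of the opposite ring; this form of
    bijectivity mentions only functionals on X and on its dual. *)
Lemma biduality_bijP X : bijective (@biduality R X) <-> reflexive_mod X.
Proof.
split=> [[h hK Kh]|[sep ev]].
  split=> [x x0|phi].
    apply: (can_inj hK); apply: homP => xi; rewrite [LHS]x0.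
    by rewrite /hom_fun /= /lin_fun /hom_fun linear0.
  exists (h phi) => xi; have := congr1 (fun f : dual (dual X) => hom_fun f xi) (Kh phi).
  by move=> /esym.
have /choice[h hh] (phi : dual (dual X)) := ev phi.
have Kh : cancel h (@biduality R X) by move=> phi; apply: homP => xi; rewrite [RHS]hh.
exists h => // x; apply/subr0_eq/sep => xi.
rewrite /hom_fun linearB; apply/subr0_eq; rewrite subr0; apply/subr0_eq.
have := congr1 (fun f : dual (dual X) => hom_fun f xi) (Kh (biduality x)).
by rewrite /hom_fun /= /lin_fun /hom_fun => ->; rewrite subrr subr0.
Qed.

Lemma projective_reflexive P : fin_gen P -> projective P -> reflexive_mod P.
Proof.
move=> fP pP; have [n [g [s hs]]] := dual_basis fP pP.
split=> [x x0|phi].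
  by rewrite [x]hs big1 // => i _; have := x0 (s i); rewrite /hom_fun => ->; rewrite scale0r.
exists (\sum_i (phi (s i : dual P) : R) *: g i) => xi.
have xiE : xi = \sum_i (hom_fun xi (g i) : R^c) *: (s i : dual P).
  apply: homP => x; rewrite dual_sum /hom_fun {1}[x]hs linear_sum /=.
  by apply: eq_bigr => i _; rewrite linearZ.
rewrite {1}xiE /hom_fun !linear_sum /=; apply: eq_bigr => i _.
by rewrite !linearZ.
Qed.

End Duality.

(** * Modules of Gorenstein dimension zero *)

Section Gorenstein.
Variable R : pzRingType.
Hypotheses (nR : noetherian R) (nRc : noetherian R^c).
Implicit Types X Y Z K P Q W : lmodType R.

Lemma dual_fin_gen X : fin_gen X -> fin_gen (dual X).
Proof.
move=> /fin_gen_cover[m [p sp]].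
apply: (nRc (i := dmap p)).
  by move=> xi eta h; apply: homP => x; have [y <-] := sp x; rewrite -!dmapE h.
by have [] := dual_fin_gen_projective (@rV_fin_gen R m) (@rV_projective R m).
Qed.

Lemma gorenstein_extends X K P (i : {linear K -> P}) (p : {linear P -> X}) :
  gorenstein_dim0 X -> projective P -> short_exact i p -> extends R^o i.
Proof. by move=> [_ _ eX _] pP se; apply: (ext_pos_vanish 0 eX) pP se. Qed.

(** The dual sequence 0 -> X* -> P* -> K* -> 0 is exact because maps K -> R
    extend to P. Hence Ext^(j+2)(K*, R) = Ext^(j+1)(X*, R), while
    Ext^1(K*, R) = 0 because a functional on X* is evaluation at a point of X,
    which lifts to P. Reflexivity of K follows from that of P, using that
    functionals separate the points of X. *)
Lemma gorenstein_syzygy X K P (i : {linear K -> P}) (p : {linear P -> X}) :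
  gorenstein_dim0 X -> fin_gen P -> projective P -> short_exact i p ->
  gorenstein_dim0 K.
Proof.
move=> gX fP pP se; have exK := gorenstein_extends gX pP se.
have dse := dual_short_exact se exK.
have [fX /biduality_bijP[sepX evX] eX edX] := gX.
have [inji sp ex] := se; have [_ dsp _] := dse.
have fK : fin_gen K by apply: nR inji fP.
have [fdP pdP] := dual_fin_gen_projective fP pP.
have [sepP evP] := projective_reflexive fP pP.
split=> //.
- apply/biduality_bijP; split=> [z z0|phi].
    apply: inji; rewrite linear0; apply: sepP => pi; exact: z0 (dmap i pi).
  have [y hy] := evP (phi \o dmap i).
  have /ex[z hz] : p y = 0.
    apply: sepX => xi; rewrite -dmapE -hy /=.
    by rewrite (short_exact_comp0 dse) linear0.
  by exists z => xi; have [pi <-] := dsp xi; rewrite dmapE hz -hy.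
- apply: ext_vanish_pos => // j.
  exact: (ext_pos_vanish j.+1 eX) pP se.
- apply: ext_vanish_pos => //; first exact: dual_fin_gen.
  apply: ext_vanish_shift pdP dse _ (fun j => ExtS_zero_vanish_some (edX j)) => f.
  have [x hx] := evX f; have [y hy] := sp x.
  have ev_lin : linear (fun pi : dual P => hom_fun pi y : R^c^o) by [].
  by exists (mklin ev_lin) => xi; rewrite hx -hy.
Qed.

(** Generators xi_1, ..., xi_m of X* embed X into R^m, in such a way that every
    functional on X extends. The dual sequence presents X* with kernel X'*, so
    that X' and X'* inherit the vanishing of Ext from X and X*. A functional on X'*
    extends to the dual of R^m because Ext^1(X*, R) = 0, so it is an evaluation. *)
Lemma gorenstein_cosyzygy X : gorenstein_dim0 X ->
  exists Q X' (i : {linear X -> Q}) (p : {linear Q -> X'}),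
    [/\ fin_gen Q, projective Q, short_exact i p & gorenstein_dim0 X'].
Proof.
move=> [fX /biduality_bijP[sepX evX] eX edX].
have [m [xi hxi]] := dual_fin_gen fX.
pose i : {linear X -> 'rV[R]_m} := mklin (row_linear (fun j => (xi j : {linear X -> R^o}))).
have inji : injective i.
  move=> x y e; apply/subr0_eq/sepX => eta; have [c ->] := hxi eta.
  rewrite dual_sum big1 // => j _; rewrite dualZ.
  rewrite [hom_fun (xi j) _](_ : _ = (i (x - y)) 0 j).
    by rewrite linearB e subrr mxE mul0r.
  by rewrite /i /mklin /= /lin_fun mxE.
have exi : extends R^o i.
  move=> eta; have [c hc] := hxi (eta : dual X).
  exists (comb (fun j => c j : R^o)) => x.
  rewrite combE [RHS](congr1 (fun f : dual X => hom_fun f x) hc) dual_sum.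
  by apply: eq_bigr => j _; rewrite dualZ /i /mklin /= /lin_fun mxE.
have pQ := @rV_projective R m; have fQ := @rV_fin_gen R m.
have [sepQ evQ] := projective_reflexive fQ pQ.
have se := short_exact_coker inji; move: (quot_proj _) se => p se.
have dse := dual_short_exact se exi.
have [_ sp ex] := se; have [dinj dsp dex] := dse.
have [fdQ pdQ] := dual_fin_gen_projective fQ pQ.
have fX' : fin_gen (quot_mod (im_sub i)) by apply: fin_gen_surj sp fQ.
exists 'rV[R]_m, (quot_mod (im_sub i)), i, p; split=> //; split=> //.
- apply/biduality_bijP; split=> [x' x'0|phi].
    have [v hv] := sp x'.
    (* all functionals on X' vanish at p v, so the value at v of an extension to
       R^m of a functional on X does not depend on the extension *)
    have [xi0|phi hphi] := factor_surj (f := mklin (@eval_linear R _ v)) dsp.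
      by move=> /dex[eta <-]; rewrite /= /lin_fun dmapE hv; apply: x'0.
    have [x hx] := evX phi.
    rewrite -hv; apply/ex; exists x; apply/subr0_eq/sepQ => eta.
    by rewrite hom_funB -dmapE -hx hphi /= /lin_fun subrr.
  have [psi hpsi] := ext_pos_vanish 0 edX _ _ _ _ pdQ dse phi.
  have [v hv] := evQ psi; exists (p v) => eta.
  by rewrite -hpsi hv.
- apply: ext_vanish_pos => //.
  exact: ext_vanish_shift pQ se exi (fun j => ExtS_zero_vanish_some (eX j)).
- apply: ext_vanish_pos => // [|j]; first exact: dual_fin_gen.
  exact: (ext_pos_vanish j.+1 edX) pdQ dse.
Qed.

Definition totally_reflexive_class (C : lmodType R -> Prop) : Prop :=
  forall X, C X ->
  [/\ fin_gen X,
      exists K P (i : {linear K -> P}) (p : {linear P -> X}),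
        [/\ projective P, short_exact i p, C K & extends R^o i]
    & exists Q X' (i : {linear X -> Q}) (p : {linear Q -> X'}),
        [/\ fin_gen Q, projective Q, short_exact i p & C X']].

(** The first kind of sequence resolves X, the second, dualized, resolves X*.
    Embedding X and X' into Q and Q' compares the biduality map of X with the
    isomorphisms Q = Q** and Q' = Q'**, whence X is reflexive; and
    Ext^1(X*, R) = 0 since a functional on X'* is evaluation at a point of X'. *)
Lemma class_gorenstein C : totally_reflexive_class C ->
  forall X, C X -> gorenstein_dim0 X.
Proof.
move=> hC.
have eC X : C X -> Ext_pos_zero X R^o.
  apply: ext_of_class => {}X /hC[_ [K [P [i [p [pP se CK ex]]]]] _].
  by exists (Cover pP se).
have cosyz X : C X -> exists Q X' (i : {linear X -> Q}) (p : {linear Q -> X'}),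
    [/\ fin_gen Q, projective Q, short_exact i p, C X' & extends R^o i].
  move=> /hC[_ _ [Q [X' [i [p [fQ pQ se CX']]]]]]; exists Q, X', i, p.
  by split=> //; apply: (ext_pos_vanish 0 (eC _ CX')) pQ se.
have refl X : C X -> reflexive_mod X.
  move=> CX; have [Q [X' [i [p [fQ pQ se CX' ex]]]]] := cosyz X CX.
  have [Q' [X'' [i' [p' [fQ' pQ' se' CX'' ex']]]]] := cosyz X' CX'.
  have dse := dual_short_exact se ex; have dse' := dual_short_exact se' ex'.
  have [inji sp e] := se; have [inji' sp' e'] := se'.
  have [_ dsp _] := dse; have [_ dsp' _] := dse'.
  have [sepQ evQ] := projective_reflexive fQ pQ.
  have [sepQ' _] := projective_reflexive fQ' pQ'.
  split=> [x x0|phi].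
    by apply: inji; rewrite linear0; apply: sepQ => pi; apply: x0 (dmap i pi).
  have [q hq] := evQ (phi \o dmap i).
  have /e[x hx] : p q = 0.
    apply: inji'; rewrite linear0; apply: sepQ' => eta.
    rewrite -!dmapE -hq /=.
    by rewrite (short_exact_comp0 dse) linear0.
  by exists x => xi; have [pi <-] := dsp xi; rewrite dmapE hx -hq.
have edC (Y : lmodType R^c) : (exists2 X, C X & Y = dual X) -> Ext_pos_zero Y R^c^o.
  move: Y; apply: ext_of_class => Y [X CX ->].
  have [Q [X' [i [p [fQ pQ se CX' ex]]]]] := cosyz X CX.
  have [_ pdQ] := dual_fin_gen_projective fQ pQ.
  exists (Cover pdQ (dual_short_exact se ex)) => /=; split; first by exists X'.
  move=> f; have [_ ev] := refl _ CX'; have [x hx] := ev f.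
  have [_ sp _] := se; have [y hy] := sp x.
  by exists (mklin (@eval_linear R _ y)) => xi; rewrite hx -hy.
move=> X CX; have [fX _ _] := hC X CX; split=> //.
- exact/biduality_bijP/refl.
- exact: eC.
- by apply: edC; exists X.
Qed.

(** Ext^1(X, W) = 0. When W is projective, f factors through some R^n as K is
    finitely generated. Otherwise let 0 -> W' -> Q -> W -> 0: by induction applied
    to K, again of Gorenstein dimension zero, f lifts to a map K -> Q, and this
    lift extends to P by the projective case. *)
Lemma gorenstein_extends_projdim m W X K P (i : {linear K -> P}) (p : {linear P -> X}) :
  projdim_le m W -> gorenstein_dim0 X -> fin_gen P -> projective P ->
  short_exact i p -> extends W i.
Proof.
have base V X' K' P' (i' : {linear K' -> P'}) (p' : {linear P' -> X'}) :
    projective V -> gorenstein_dim0 X' -> fin_gen P' -> projective P' ->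
    short_exact i' p' -> extends V i'.
  move=> pV gX fP pP se f; have [inj _ _] := se.
  have [n [a [b hb]]] := projective_factor_free f pV (nR inj fP).
  have /choice[c hc] j := gorenstein_extends gX pP se (mklin (@entry_linear R n j) \o a).
  exists (b \o mklin (row_linear c)) => z; rewrite -hb /=; congr (b _).
  by apply/rowP => j; rewrite /mklin /= /lin_fun mxE hc.
elim: m W X K P i p => [|m IHm] W X K P i p /=; first exact: base.
move=> [Q [W' [j [q [pQ seW pdW]]]]] gX fP pP se f.
have gK := gorenstein_syzygy gX fP pP se; have [fK _ _ _] := gK.
have [c [fP' fK']] := fin_gen_cover_noetherian nR fK.
have [pP' se'] := (cov_proj c, cov_exact c).
have [_ sq eq] := seW; have [_ sp' ep'] := se'.
(* lift f to P' -> Q on a cover P' of K, and correct the lift by a map P' -> W'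
   so that it vanishes on the kernel of the cover *)
have [h hh] := pP' _ _ q (f \o cov_p c) sq.
have [z|h' hh'] := short_exact_factor (g := h \o cov_i c) seW.
  by rewrite /= hh /= (short_exact_comp0 se') linear0.
have [l hl] := IHm _ _ _ _ _ _ pdW gK fP' pP' se' h'.
have [y|f' hf'] := factor_surj (f := h \- (j \o l)) sp'.
  by move=> /ep'[z <-] /=; rewrite hl hh' subrr.
have [g hg] := base _ _ _ _ _ _ pQ gX fP pP se f'.
exists (q \o g) => z /=; rewrite hg; have [y <-] := sp' z.
by rewrite hf' /= linearB hh (short_exact_comp0 seW) subr0.
Qed.

End Gorenstein.

(** * Fully faithful and essentially surjective functors *)

#[export] Instance heq_equivalence (C : category) (X Y : C) : Equivalence (@heq C X Y).
Proof.
by split=> [f|f g|f g h]; [apply: heq_refl|apply: heq_sym|apply: heq_trans].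
Qed.

#[export] Instance mcomp_proper (C : category) (X Y Z : C) :
  Proper (@heq C Y Z ==> @heq C X Y ==> @heq C X Z) (@mcomp C X Y Z).
Proof. by move=> f f' ef g g' eg; apply: comp_heq. Qed.

#[export] Instance fmap_proper (C D : category) (F : functor C D) (X Y : C) :
  Proper (@heq C X Y ==> @heq D (F X) (F Y)) (@fmap C D F X Y).
Proof. by move=> f g; apply: fmap_heq. Qed.

Section WeakEquivalence.
Implicit Types C D E : category.

Definition faithful C D (F : functor C D) : Prop :=
  forall (X Y : C) (f g : mor X Y), heq (fmap F f) (fmap F g) -> heq f g.
Definition full C D (F : functor C D) : Prop :=
  forall (X Y : C) (g : mor (F X) (F Y)), exists f : mor X Y, heq (fmap F f) g.
Definition iso_ob C (X Y : C) : Prop :=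
  exists (f : mor X Y) (g : mor Y X),
    heq (mcomp g f) (idm X) /\ heq (mcomp f g) (idm Y).
Definition ess_surj C D (F : functor C D) : Prop :=
  forall Y : D, exists X : C, iso_ob (F X) Y.
(** Closed under composition and natural isomorphism without any choice of
    inverses, which is what the final argument needs. *)
Definition weak_equivalence C D (F : functor C D) : Prop :=
  [/\ faithful F, full F & ess_surj F].

Lemma cancel_heql C (X Y Z : C) (s : mor Y X) (t : mor X Y) (f : mor Z X) :
  heq (mcomp s t) (idm X) -> heq (mcomp s (mcomp t f)) f.
Proof. by move=> e; setoid_rewrite compA; setoid_rewrite e; apply: compIm. Qed.

Lemma cancel_heqr C (X Y Z : C) (s : mor Y X) (t : mor X Y) (f : mor X Z) :
  heq (mcomp s t) (idm X) -> heq (mcomp (mcomp f s) t) f.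
Proof. by move=> e; setoid_rewrite <- compA; setoid_rewrite e; apply: compmI. Qed.

Lemma iso_ob_trans C (X Y Z : C) : iso_ob X Y -> iso_ob Y Z -> iso_ob X Z.
Proof.
move=> [f [g [gf fg]]] [f' [g' [gf' fg']]].
exists (mcomp f' f), (mcomp g g'); split.
- apply: heq_trans gf; setoid_rewrite <- compA; apply: comp_heq; first exact: heq_refl.
  exact: cancel_heql.
- apply: heq_trans fg'; setoid_rewrite <- compA; apply: comp_heq; first exact: heq_refl.
  exact: cancel_heql.
Qed.

Lemma fmap_iso_ob C D (F : functor C D) (X Y : C) : iso_ob X Y -> iso_ob (F X) (F Y).
Proof.
move=> [f [g [gf fg]]]; exists (fmap F f), (fmap F g); split.
- by setoid_rewrite <- fmap_comp; setoid_rewrite gf; apply: fmap_id.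
- by setoid_rewrite <- fmap_comp; setoid_rewrite fg; apply: fmap_id.
Qed.

Lemma weak_equivalence_id C : weak_equivalence (functor_id C).
Proof.
split=> // [X Y g|X]; first by exists g; apply: heq_refl.
by exists X, (idm X), (idm X); split; apply: compIm.
Qed.

Lemma weak_equivalence_comp C D E (G : functor D E) (F : functor C D) :
  weak_equivalence G -> weak_equivalence F -> weak_equivalence (functor_comp G F).
Proof.
move=> [faG fuG esG] [faF fuF esF]; split=> [X Y f g /faG/faF //|X Y g|Z].
  have [h hh] := fuG _ _ g; have [f hf] := fuF _ _ h.
  by exists f; apply: heq_trans hh; apply: fmap_heq.
have [Y iY] := esG Z; have [X iX] := esF Y; exists X.
by apply: iso_ob_trans iY; apply: (fmap_iso_ob G iX).
Qed.

Lemma weak_equivalence_iter C (S : functor C C) n :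
  weak_equivalence S -> weak_equivalence (functor_iter n S).
Proof.
move=> wS; elim: n => [|n IHn]; first exact: weak_equivalence_id.
exact: weak_equivalence_comp.
Qed.

Lemma weak_equivalence_nat_iso C D (F G : functor C D) :
  nat_iso F G -> weak_equivalence G -> weak_equivalence F.
Proof.
move=> [t [s [st ts nat]]] [faG fuG esG]; split=> [X Y f g e|X Y g|Z].
- apply: faG; apply: heq_trans (heq_sym (cancel_heqr (fmap G f) (ts X))) _.
  apply: heq_trans (cancel_heqr (fmap G g) (ts X)).
  apply: comp_heq; last exact: heq_refl.
  by setoid_rewrite <- nat; setoid_rewrite e; apply: heq_refl.
- have [f hf] := fuG X Y (mcomp (t Y) (mcomp g (s X))); exists f.
  apply: heq_trans (heq_sym (cancel_heql (fmap F f) (st Y))) _.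
  setoid_rewrite nat; setoid_rewrite hf.
  setoid_rewrite <- (compA (t Y)).
  apply: heq_trans (cancel_heql _ (st Y)) _.
  exact: cancel_heqr (st X).
- have [X iX] := esG Z; exists X; apply: iso_ob_trans iX.
  by exists (t X), (s X).
Qed.

(** Faithfulness of F comes from G F, essential surjectivity from F G. For fullness,
    G g = G F f for some f, and G is faithful because F G is. *)
Lemma weak_equivalence_factor C D (F : functor C D) (G : functor D C) :
  weak_equivalence (functor_comp G F) -> weak_equivalence (functor_comp F G) ->
  weak_equivalence F.
Proof.
move=> [faGF fuGF _] [faFG _ esFG]; split=> [X Y f g e|X Y g|Y].
- by apply: faGF; apply: (fmap_heq G).
- have [f hf] := fuGF X Y (fmap G g); exists f.
  by apply: faFG; apply: (fmap_heq F).
- by have [X iX] := esFG Y; exists (G X).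
Qed.

Lemma weak_equivalence_is_equivalence C D (F : functor C D) :
  weak_equivalence F -> is_equivalence F.
Proof.
move=> [faF fuF esF].
pose G0 (Y : D) : C := projT1 (cid (esF Y)).
pose iG (Y : D) : iso_ob (F (G0 Y)) Y := projT2 (cid (esF Y)).
pose e (Y : D) := projT1 (cid (iG Y)).
pose e' (Y : D) := projT1 (cid (projT2 (cid (iG Y)))).
have e'e Y : heq (mcomp (e' Y) (e Y)) (idm (F (G0 Y))).
  by rewrite /e /e'; case: cid => /= ? h; case: cid => /= ? [].
have ee' Y : heq (mcomp (e Y) (e' Y)) (idm Y).
  by rewrite /e /e'; case: cid => /= ? h; case: cid => /= ? [].
pose pre X Y (g : mor (F X) (F Y)) : mor X Y := projT1 (cid (fuF X Y g)).
have preE X Y (g : mor (F X) (F Y)) : heq (fmap F (pre X Y g)) g.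
  by rewrite /pre; case: cid.
pose G1 Y Y' (g : mor Y Y') : mor (G0 Y) (G0 Y') :=
  pre _ _ (mcomp (e' Y') (mcomp g (e Y))).
have Gheq Y Y' (f g : mor Y Y') : heq f g -> heq (G1 _ _ f) (G1 _ _ g).
  by move=> fg; apply: faF; rewrite /G1; setoid_rewrite preE; setoid_rewrite fg; apply: heq_refl.
have Gid Y : heq (G1 _ _ (idm Y)) (idm (G0 Y)).
  apply: faF; rewrite /G1; setoid_rewrite preE; setoid_rewrite compIm.
  by setoid_rewrite e'e; setoid_rewrite fmap_id; apply: heq_refl.
have Gcomp X Y Z (f : mor Y Z) (g : mor X Y) :
    heq (G1 _ _ (mcomp f g)) (mcomp (G1 _ _ f) (G1 _ _ g)).
  apply: faF; setoid_rewrite fmap_comp; rewrite /G1; setoid_rewrite preE.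
  setoid_rewrite <- compA; apply: comp_heq; first exact: heq_refl.
  setoid_rewrite <- compA; apply: comp_heq; first exact: heq_refl.
  by apply: heq_sym; apply: cancel_heql.
exists (Functor Gheq Gid Gcomp); split.
- exists (fun X => pre _ _ (e (F X))), (fun X => pre _ _ (e' (F X))); split=> [X|X|X Y f].
  + apply: faF; setoid_rewrite fmap_comp; setoid_rewrite preE.
    by setoid_rewrite e'e; setoid_rewrite fmap_id; apply: heq_refl.
  + apply: faF; setoid_rewrite fmap_comp; setoid_rewrite preE.
    by setoid_rewrite ee'; setoid_rewrite fmap_id; apply: heq_refl.
  + apply: faF; setoid_rewrite fmap_comp; rewrite /= /G1; setoid_rewrite preE.
    exact: cancel_heql.
- exists e, e'; split=> // X Y f.
  by rewrite /= /G1; setoid_rewrite preE; apply: cancel_heql.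
Qed.

End WeakEquivalence.

(** * The syzygy functor *)

Section Lift.
Variable R : pzRingType.
Implicit Types X Y K P Q : lmodType R.

(** f' is induced on syzygies by the map f. *)
Definition is_lift X X' K K' P P' (i : {linear K -> P}) (p : {linear P -> X})
    (i' : {linear K' -> P'}) (p' : {linear P' -> X'})
    (f : {linear X -> X'}) (f' : {linear K -> K'}) : Prop :=
  exists h : {linear P -> P'},
    (forall y, p' (h y) = f (p y)) /\ forall z, i' (f' z) = h (i z).

Section TwoCovers.
Variables (X X' K K' P P' : lmodType R) (i : {linear K -> P}) (p : {linear P -> X}).
Variables (i' : {linear K' -> P'}) (p' : {linear P' -> X'}).
Hypotheses (se : short_exact i p) (se' : short_exact i' p').
Hypotheses (fP : fin_gen P) (pP : projective P).

Lemma lift_exists (f : {linear X -> X'}) : exists f', is_lift i p i' p' f f'.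
Proof.
have [_ sp' _] := se'; have [h hh] := pP (f \o p) sp'.
have [z|f' hf'] := short_exact_factor (g := h \o i) se'.
  by rewrite /= hh /= (short_exact_comp0 se) linear0.
by exists f', h.
Qed.

(** If f - g factors through Q, the part through Q lifts to P' and vanishes on K;
    what remains of the difference of the lifts takes values in K', so it
    factors K -> P -> K'. *)
Lemma lift_stable_eq (f g : {linear X -> X'}) (f' g' : {linear K -> K'}) :
  stable_eq f g -> is_lift i p i' p' f f' -> is_lift i p i' p' g g' ->
  stable_eq f' g'.
Proof.
move=> [Q [u [v [fQ pQ e]]]] [h [hf hf']] [l [lg lg']].
have [inj' sp' _] := se'; have [w hw] := pQ _ _ p' v sp'.
have [y|c hc] := short_exact_factor (g := (h \- l) \- (w \o (u \o p))) se'.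
  by rewrite /= !linearB hf lg hw /= -e subrr.
exists P, i, c; split=> // z; apply: inj'.
by rewrite linearB hf' lg' hc /= (short_exact_comp0 se) !linear0 addr0.
Qed.

End TwoCovers.

Lemma lift_id X K P (i : {linear K -> P}) (p : {linear P -> X}) :
  is_lift i p i p idfun idfun.
Proof. by exists idfun. Qed.

Lemma lift_comp X X' X'' K K' K'' P P' P'' (i : {linear K -> P}) (p : {linear P -> X})
    (i' : {linear K' -> P'}) (p' : {linear P' -> X'})
    (i'' : {linear K'' -> P''}) (p'' : {linear P'' -> X''})
    (f : {linear X' -> X''}) (g : {linear X -> X'})
    (f' : {linear K' -> K''}) (g' : {linear K -> K'}) :
  is_lift i' p' i'' p'' f f' -> is_lift i p i' p' g g' ->
  is_lift i p i'' p'' (f \o g) (f' \o g').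
Proof.
move=> [h [h1 h2]] [l [l1 l2]]; exists (h \o l).
by split=> y /=; [rewrite h1 l1 | rewrite h2 l2].
Qed.

Lemma stable_iso_lift X X' K K' P P' (i : {linear K -> P}) (p : {linear P -> X})
    (i' : {linear K' -> P'}) (p' : {linear P' -> X'})
    (f : {linear X -> X'}) (g : {linear X' -> X})
    (f' : {linear K -> K'}) (g' : {linear K' -> K}) :
  short_exact i p -> short_exact i' p' ->
  fin_gen P -> projective P ->
  stable_eq (g \o f) idfun ->
  is_lift i p i' p' f f' -> is_lift i' p' i p g g' ->
  stable_eq (g' \o f') idfun.
Proof.
move=> se se' fP pP gf lf lg.
apply: (lift_stable_eq se se fP pP gf); last exact: lift_id.
exact: lift_comp lg lf.
Qed.

End Lift.

Section SyzygyFunctor.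
Variable R : pzRingType.
Hypotheses (nR : noetherian R) (nRc : noetherian R^c).

Definition stG_gor (X : stG R) : gorenstein_dim0 (stG_mod X) := svalP X.

Definition syz_cover (X : stG R) :=
  cid (fin_gen_cover_noetherian nR (fgmodP (sval X))).
Definition syz_P (X : stG R) : lmodType R := cov_P (projT1 (syz_cover X)).
Definition syz_K (X : stG R) : lmodType R := cov_K (projT1 (syz_cover X)).
Definition syz_i (X : stG R) : {linear syz_K X -> syz_P X} := cov_i (projT1 (syz_cover X)).
Definition syz_p (X : stG R) : {linear syz_P X -> stG_mod X} := cov_p (projT1 (syz_cover X)).

Lemma syz_fgP X : fin_gen (syz_P X).
Proof. by rewrite /syz_P; case: (syz_cover X) => /= ? []. Qed.
Lemma syz_fgK X : fin_gen (syz_K X).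
Proof. by rewrite /syz_K; case: (syz_cover X) => /= ? []. Qed.
Lemma syz_proj X : projective (syz_P X).
Proof. exact: cov_proj. Qed.
Lemma syz_exact X : short_exact (syz_i X) (syz_p X).
Proof. exact: cov_exact. Qed.
Lemma syz_gor X : gorenstein_dim0 (syz_K X).
Proof.
exact: (gorenstein_syzygy nR nRc) (stG_gor X) (@syz_fgP X) (@syz_proj X) (syz_exact X).
Qed.

Definition syz_ob (X : stG R) : stG R :=
  exist (fun X : stmod R => gorenstein_dim0 (fgmod_mod X)) (FgMod (@syz_fgK X)) (syz_gor X).

Definition syz_lift (X Y : stG R) (f : {linear stG_mod X -> stG_mod Y})
    (f' : {linear stG_mod (syz_ob X) -> stG_mod (syz_ob Y)}) : Prop :=
  is_lift (syz_i X) (syz_p X) (syz_i Y) (syz_p Y) f f'.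

Lemma syz_lift_ex (X Y : stG R) (f : {linear stG_mod X -> stG_mod Y}) :
  exists f', syz_lift f f'.
Proof. exact: lift_exists (syz_exact X) (syz_exact Y) (@syz_proj X) f. Qed.

Definition syz_map (X Y : stG R) (f : {linear stG_mod X -> stG_mod Y}) :=
  projT1 (cid (syz_lift_ex f)).
Lemma syz_mapP (X Y : stG R) (f : {linear stG_mod X -> stG_mod Y}) :
  syz_lift f (syz_map f).
Proof. exact: (projT2 (cid (syz_lift_ex f))). Qed.

Lemma syz_lift_stable (X Y : stG R) (f g : {linear stG_mod X -> stG_mod Y}) f' g' :
  stable_eq f g -> syz_lift f f' -> syz_lift g g' -> stable_eq f' g'.
Proof.
exact: (lift_stable_eq (syz_exact X) (syz_exact Y) (@syz_fgP X) (@syz_proj X)).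
Qed.

Definition syz_functor : functor (stG R) (stG R).
Proof.
apply: (@Functor (stG R) (stG R) syz_ob syz_map).
- by move=> X Y f g e; apply: syz_lift_stable e (syz_mapP _) (syz_mapP _).
- move=> X; apply: syz_lift_stable (stable_eq_refl _) (syz_mapP _) _.
  exact: lift_id.
- move=> X Y Z f g; apply: syz_lift_stable (stable_eq_refl _) (syz_mapP _) _.
  exact: lift_comp (syz_mapP f) (syz_mapP g).
Defined.

Lemma syz_fmapP (X Y : stG R) (f : mor X Y) :
  syz_lift (f : {linear stG_mod X -> stG_mod Y}) (fmap syz_functor f).
Proof. exact: syz_mapP. Qed.

Lemma syz_functorP : is_syzygy_functor syz_functor.
Proof.
exists syz_P, syz_i, syz_p; split=> [X|X Y f].
  by split; [apply: syz_fgP|apply: syz_proj|apply: syz_exact].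
have [h [h1 h2]] := syz_mapP f.
by exists h, (syz_map f); split=> //; apply: stable_eq_refl.
Qed.

(** Maps from a syzygy to a projective module extend to the cover. Faithful: a
    factorization of f' - g' through Q extends to the covers, and after
    subtracting it f - g factors through the cover of Y. Full: a map between
    syzygies extends to the covers and induces one on the quotients.
    Essentially surjective: X is a syzygy of its cosyzygy. *)
Lemma syz_weak_equivalence : weak_equivalence syz_functor.
Proof.
have ext (X : stG R) Q : projective Q -> extends Q (syz_i X).
  move=> pQ; apply: (gorenstein_extends_projdim nR nRc (m := 0) pQ (stG_gor X)).
  - exact: syz_fgP.
  - exact: syz_proj.
  - exact: syz_exact.
split=> [X Y f g [Q [u [v [fQ pQ e]]]]|X Y f|X].
- have [inj sp ex] := syz_exact X; have [injY spY exY] := syz_exact Y.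
  have [h [h1 h2]] := syz_mapP f; have [l [l1 l2]] := syz_mapP g.
  have [w hw] := ext X Q pQ u.
  have [y|a ha] := factor_surj (f := (h \- l) \- (syz_i Y \o (v \o w))) sp.
    by move=> /ex[z <-] /=; rewrite hw -e -h2 -l2 linearB subrr.
  exists (syz_P Y), a, (syz_p Y); split; [exact: syz_fgP|exact: syz_proj|].
  move=> x; have [y <-] := sp x.
  by rewrite ha /= !linearB (short_exact_comp0 (syz_exact Y)) subr0 h1 l1.
- have [h hh] := ext X _ (@syz_proj Y) (syz_i Y \o f).
  have [_ sp ex] := syz_exact X.
  have [y|g hg] := factor_surj (f := syz_p Y \o h) sp.
    by move=> /ex[z <-] /=; rewrite hh (short_exact_comp0 (syz_exact Y)).
  exists g; apply: syz_lift_stable (stable_eq_refl g) (syz_mapP g) _.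
  by exists h; split=> [y|z]; [rewrite hg | rewrite hh].
- have [Q [X' [i [p [fQ pQ se gX']]]]] := gorenstein_cosyzygy nR nRc (stG_gor X).
  have [fX' _ _ _] := gX'.
  pose Y : stG R := exist (fun X : stmod R => gorenstein_dim0 (fgmod_mod X)) (FgMod fX') gX'.
  have sY := syz_exact Y.
  have [f hf] := lift_exists sY se (@syz_proj Y) idfun.
  have [g hg] := lift_exists se sY pQ idfun.
  have id2 (Z : lmodType R) : stable_eq ((idfun : {linear Z -> Z}) \o (idfun : {linear Z -> Z})) idfun.
    by apply: stable_eq_ext.
  have e1 := stable_iso_lift sY se (@syz_fgP Y) (@syz_proj Y) (id2 _) hf hg.
  have e2 := stable_iso_lift se sY fQ pQ (id2 _) hg hf.
  by exists Y, f, g.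
Qed.

End SyzygyFunctor.

(** * Exactness and projectivity of tensor products *)

Section EnvelopingCoordinates.
Variables (k : fieldType) (A B : falgType k).
Implicit Types z : envalg A B.

Lemma env_coord_bal l :
  balanced (fun (a : A) (c : k) => c *: a) (fun (c : k) (b : B) => c *: b)
    (fun a b => coord (vbasis (fullv : {vspace A})) l a *: b).
Proof.
split=> [m n x|m x y|m c x]; first by rewrite linearD scalerDl.
  exact: scalerDr.
by rewrite linearZ /= scalerA mulrC.
Qed.

(** A (x) B^op is free as a right B-module on a basis of A. *)
Definition env_coord l z : B :=
  tlift (fun a b => coord (vbasis (fullv : {vspace A})) l a *: b) z.

Lemma env_coord_pure l a b :
  env_coord l (epure a b) = coord (vbasis (fullv : {vspace A})) l a *: b.
Proof. exact: tliftE (env_coord_bal l) _ _. Qed.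
Lemma env_coordD l : {morph env_coord l : z w / z + w}.
Proof. exact: tliftD (env_coord_bal l). Qed.
Lemma env_coord0 l : env_coord l 0 = 0.
Proof. exact: tlift0 (env_coord_bal l). Qed.

Lemma epure0 a : epure a 0 = 0 :> envalg A B.
Proof. by apply: (addrI (epure a 0)); rewrite -epureDr !addr0. Qed.
Lemma epure0l b : epure 0 b = 0 :> envalg A B.
Proof. by apply: (addrI (epure 0 b)); rewrite -epureDl !addr0. Qed.

Lemma env_coordE z : z = \sum_l epure (alg_bas l) (env_coord l z).
Proof.
elim/envalg_ind: z => [|z w hz hw|a b].
- by rewrite big1 // => l _; rewrite env_coord0 epure0.
- rewrite {1}hz {1}hw -big_split; apply: eq_bigr => l _ /=.
  by rewrite env_coordD epureDr.
have D : {morph (fun a => epure a b : envalg A B) : x y / x + y}.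
  by move=> x y; apply: epureDl.
rewrite {1}[a]alg_basE (big_morph _ D (epure0l b)); apply: eq_bigr => l _.
by rewrite epureZ env_coord_pure.
Qed.

Lemma env_coordMr l z b : env_coord l (epure 1 b * z) = env_coord l z * b.
Proof.
elim/envalg_ind: z => [|z w hz hw|a c]; first by rewrite mulr0 env_coord0 mul0r.
  by rewrite mulrDr !env_coordD hz hw mulrDl.
by rewrite epureM !env_coord_pure mul1r scalerAl.
Qed.

Lemma rres_fin_gen (M : lmodType (envalg A B)) : fin_gen M -> fin_gen (rres M).
Proof.
move=> [n [g hg]].
apply: (@fin_genI _ _ _ (fun u : 'I_n * 'I_(\dim (fullv : {vspace A})) =>
   lact (alg_bas u.2) (g u.1) : rres M)) => x.
have [c {1}->] := hg x; exists (fun u => env_coord u.2 (c u.1)).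
rewrite -(pair_bigA _ (fun i l => (env_coord l (c i) : B^c) *: (lact (alg_bas l) (g i) : rres M))) /=.
apply: eq_bigr => i _; rewrite {1}[c i]env_coordE scaler_suml; apply: eq_bigr => l _.
by rewrite epure_act lract.
Qed.

(** Coordinates in the dual basis followed by coordinates in A (x) B^op give a
    dual basis of P as a right module. *)
Lemma rres_projective (P : lmodType (envalg A B)) :
  fin_gen P -> projective P -> projective (rres P).
Proof.
move=> fP pP X Y p f /choice[t ht].
have [n [g [s hs]]] := dual_basis fP pP.
pose h (x : rres P) : X := \sum_i \sum_l
  (env_coord l (s i x) : B^c) *: t (f (lact (alg_bas l) (g i) : rres P)).
have h_lin : linear h.
  move=> b x y; rewrite /h scaler_sumr -big_split; apply: eq_bigr => i _ /=.
  rewrite scaler_sumr -big_split; apply: eq_bigr => l _ /=.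
  rewrite scalerA -scalerDl; congr (_ *: _).
  rewrite [s i _](_ : _ = epure 1 b * s i x + s i y) ?env_coordD ?env_coordMr //.
  exact: (linearP (s i)).
exists (mklin h_lin) => x; rewrite linear_sum.
have xE : x = \sum_i \sum_l
    (env_coord l (s i x) : B^c) *: (lact (alg_bas l) (g i) : rres P).
  rewrite {1}[x](hs x); apply: eq_bigr => i _.
  rewrite {1}[s i x]env_coordE scaler_suml; apply: eq_bigr => l _.
  by rewrite epure_act lract.
rewrite [in RHS]xE linear_sum; apply: eq_bigr => i _.
by rewrite !linear_sum; apply: eq_bigr => l _; rewrite !linearZ ht.
Qed.

End EnvelopingCoordinates.

Section TensorMaps.
Variables (k : fieldType) (A B : falgType k).
Implicit Types M : lmodType (envalg A B).

Lemma mpure0l M (X : lmodType B) (x : X) : mpure (0 : M) x = 0.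
Proof. by apply: (addrI (mpure (0 : M) x)); rewrite -mpureDl !addr0. Qed.
Lemma mpure0r M (X : lmodType B) (m : M) : mpure m (0 : X) = 0.
Proof. by apply: (addrI (mpure m (0 : X))); rewrite -mpureDr !addr0. Qed.
Lemma mpure_suml M (X : lmodType B) (I : Type) (r : seq I) (F : I -> M) (x : X) :
  mpure (\sum_(i <- r) F i) x = \sum_(i <- r) mpure (F i) x.
Proof.
have D : {morph (fun m : M => mpure m x) : u v / u + v} by move=> u v; apply: mpureDl.
exact: (big_morph _ D (mpure0l M x)).
Qed.
Section Lift.
Variables (M : lmodType (envalg A B)) (X : lmodType B) (Z : lmodType A).
Variable b : M -> X -> Z.
Hypothesis b_bal : balanced (@ract k A B M) (fun (b : B) (x : X) => b *: x) b.
Hypothesis b_lin : forall a m x, b (lact a m) x = a *: b m x.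

Lemma tensmod_lift_linear : linear (fun t : tensmod M X => tlift b t).
Proof.
move=> a s t; rewrite tliftD //; congr (_ + _).
elim/tensmod_ind: s => [|s s' e e'|m x]; first by rewrite scaler0 tlift0 ?scaler0.
  by rewrite scalerDr !tliftD // e e' scalerDr.
by rewrite tensmod_scaleE !tliftE.
Qed.

Lemma tensmod_lift : exists f : {linear tensmod M X -> Z},
  forall m x, f (mpure m x) = b m x.
Proof. by exists (mklin tensmod_lift_linear) => m x; apply: tliftE. Qed.

End Lift.

Lemma tensmod_ext M (X : lmodType B) (Z : lmodType A) (f g : {linear tensmod M X -> Z}) :
  (forall m x, f (mpure m x) = g (mpure m x)) -> f =1 g.
Proof.
by move=> e; elim/tensmod_ind=> [|s t hs ht|//]; rewrite ?linear0 // !linearD hs ht.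
Qed.

Section LeftMap.
Variables (M M' : lmodType (envalg A B)) (phi : {linear rres M -> rres M'}).
Variable X : lmodType B.

Lemma tmapl_bal : balanced (@ract k A B M) (fun (b : B) (x : X) => b *: x)
  (fun m x => mpure (phi m : M') x).
Proof.
split=> [m n x|m x y|m b x].
- by rewrite -mpureDl; congr mpure; apply: (linearD phi).
- exact: mpureDr.
- by rewrite -mpureM; congr mpure; apply: (linearZ_LR phi b m).
Qed.

(** Only right linearity of phi is used, because the sections of bimodule maps
    that are needed below are linear on one side. *)
Definition tmapl_fun (t : tensmod M X) : tensmod M' X :=
  tlift (fun m x => mpure (phi m : M') x) t.
Lemma tmapl_funE m x : tmapl_fun (mpure m x) = mpure (phi m : M') x.
Proof. exact: tliftE tmapl_bal _ _. Qed.
Lemma tmapl_funD : {morph tmapl_fun : s t / s + t}.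
Proof. exact: tliftD tmapl_bal. Qed.
Lemma tmapl_fun0 : tmapl_fun 0 = 0.
Proof. exact: tlift0 tmapl_bal. Qed.

End LeftMap.

Section BimoduleMap.
Variables (M M' : lmodType (envalg A B)) (phi : {linear M -> M'}).

Lemma rres_linear : linear (fun m : rres M => phi (m : M) : rres M').
Proof. by move=> b m n; apply: (linearP phi). Qed.
Definition rres_map : {linear rres M -> rres M'} := mklin rres_linear.

Variable X : lmodType B.

Lemma tmapl_linear : linear (@tmapl_fun _ _ rres_map X).
Proof.
apply: (tensmod_lift_linear (tmapl_bal _ _)) => a m x.
by rewrite tensmod_scaleE; congr mpure; apply: (linearZ_LR phi).
Qed.
Definition tmapl : {linear tensmod M X -> tensmod M' X} := mklin tmapl_linear.
Lemma tmaplE m x : tmapl (mpure m x) = mpure (phi m) x.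
Proof. exact: tmapl_funE. Qed.

End BimoduleMap.

Lemma tmap_tmapl M M' (phi : {linear M -> M'}) (X Y : lmodType B) (f : {linear X -> Y}) t :
  tmap M' f (tmapl phi X t) = tmapl phi Y (tmap M f t).
Proof.
move: t; apply: (@tensmod_ext M X _ (tmap M' f \o tmapl phi X) (tmapl phi Y \o tmap M f)).
by move=> m x; rewrite /= tmaplE !tmapE tmaplE.
Qed.

(** As right modules the sequence splits, so it stays exact after tensoring, and
    K is a direct summand of P. *)
Lemma tmapl_short_exact (K P Z : lmodType (envalg A B)) (i : {linear K -> P})
    (p : {linear P -> Z}) :
  short_exact i p -> projective (rres Z) ->
  (forall X, short_exact (tmapl i X) (tmapl p X)) /\
  (projective (rres P) -> projective (rres K)).
Proof.
move=> se pZ; have [inj sp ex] := se.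
have [sg hsg] := pZ _ _ (rres_map p) idfun sp.
have [z|rh hrh] := @factor_inj _ _ _ _ (rres_map i) (idfun \- (sg \o rres_map p)) inj.
  apply/ex; rewrite [LHS](linearB (rres_map p) z) [X in _ - X]hsg; exact: subrr.
have rhi z : rh (i z) = z.
  apply: inj; rewrite [LHS]hrh.
  have e : rres_map p (i z) = 0 := short_exact_comp0 se z.
  by rewrite [LHS]/= e linear0 subr0.
split=> [X|]; last exact: (@projective_retract _ _ _ (rres_map i) rh rhi).
(* the splitting sg of p and the retraction rh of i split the tensored sequence *)
have rK t : tmapl_fun rh (tmapl i X t) = t.
  elim/tensmod_ind: t => [|s t hs ht|m x]; first by rewrite linear0 tmapl_fun0.
    by rewrite linearD tmapl_funD hs ht.
  by rewrite tmaplE tmapl_funE rhi.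
have dec t : tmapl i X (tmapl_fun rh t) + tmapl_fun sg (tmapl p X t) = t.
  elim/tensmod_ind: t => [|s t hs ht|m x].
  - by rewrite tmapl_fun0 !linear0 tmapl_fun0 addr0.
  - by rewrite tmapl_funD !linearD tmapl_funD addrACA hs ht.
  - rewrite tmapl_funE !tmaplE tmapl_funE -mpureDl; congr mpure.
    have e : i (rh m) = m - sg (p m) := hrh m.
    by rewrite e subrK.
split=> [s t e|t|t].
- by rewrite -[s]rK e rK.
- exists (tmapl_fun sg t); elim/tensmod_ind: t => [|s t hs ht|m x].
  + by rewrite tmapl_fun0 linear0.
  + by rewrite tmapl_funD linearD hs ht.
  + by rewrite tmapl_funE tmaplE; congr mpure; apply: (hsg m).
split=> [e|[s <-]]; first by exists (tmapl_fun rh t); rewrite -{2}[t]dec e tmapl_fun0 addr0.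
elim/tensmod_ind: s => [|s t' hs ht|m x]; first by rewrite !linear0.
  by rewrite !linearD hs ht addr0.
by rewrite !tmaplE (short_exact_comp0 se) mpure0l.
Qed.

(** The coordinates of a right dual basis of M identify M (x) X, naturally in X,
    with a direct summand of a finite power of X. *)
Lemma tmap_short_exact M (K P X : lmodType B) (i : {linear K -> P}) (p : {linear P -> X}) :
  fin_gen M -> projective (rres M) -> short_exact i p ->
  short_exact (tmap M i) (tmap M p).
Proof.
move=> /rres_fin_gen fM pM se; have [inj sp ex] := se.
have [n [g [s hs]]] := dual_basis fM pM.
(* coordinates of M (x) Y, with values in Y *)
pose tau (Y : lmodType B) j (t : tensmod M Y) : Y :=
  tlift (fun m y => (s j m : B) *: y) t.
have bal (Y : lmodType B) j : balanced (@ract k A B M) (fun (b : B) (y : Y) => b *: y)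
    (fun m y => (s j m : B) *: y).
  split=> [m m' y|m y y'|m b y].
  - by rewrite -scalerDl; congr (_ *: _); apply: (linearD (s j)).
  - exact: scalerDr.
  - by rewrite scalerA; congr (_ *: _); apply: (linearZ_LR (s j) b m).
have tauD Y j : {morph @tau Y j : u v / u + v} := tliftD (bal Y j).
have tau0 Y j : @tau Y j 0 = 0 := tlift0 (bal Y j).
have tauE Y j m y : @tau Y j (mpure m y) = (s j m : B) *: y := tliftE (bal Y j) m y.
have tau_sum Y (t : tensmod M Y) : t = \sum_j mpure (g j) (tau Y j t).
  elim/tensmod_ind: t => [|u v hu hv|m y].
  - by rewrite big1 // => j _; rewrite tau0 mpure0r.
  - by rewrite {1}hu {1}hv -big_split; apply: eq_bigr => j _; rewrite tauD mpureDr.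
  - rewrite {1}[m](hs m) mpure_suml; apply: eq_bigr => j _.
    by rewrite tauE -mpureM.
have tau_map (Y Y' : lmodType B) (f : {linear Y -> Y'}) j t : tau Y' j (tmap M f t) = f (tau Y j t).
  elim/tensmod_ind: t => [|u v hu hv|m y]; first by rewrite linear0 !tau0 linear0.
    by rewrite linearD !tauD hu hv linearD.
  by rewrite tmapE !tauE linearZ.
split=> [u v e|t|t].
- rewrite [u]tau_sum [v]tau_sum; apply: eq_bigr => j _; congr mpure.
  by apply: inj; rewrite -!tau_map e.
- have /choice[y hy] j := sp (tau _ j t); exists (\sum_j mpure (g j) (y j)).
  rewrite linear_sum [RHS]tau_sum; apply: eq_bigr => j _.
  by rewrite tmapE hy.
split=> [e|[u <-]]; last first.
  rewrite [LHS]tau_sum big1 // => j _.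
  by rewrite !tau_map (short_exact_comp0 se) mpure0r.
have /choice[y hy] j : exists y, i y = tau _ j t by apply/ex; rewrite -tau_map e tau0.
exists (\sum_j mpure (g j) (y j)).
rewrite linear_sum [RHS]tau_sum; apply: eq_bigr => j _.
by rewrite tmapE hy.
Qed.

(** P is a summand of a power of A (x) B^op, and (A (x) B^op) (x)_B X = A (x)_k X
    is free over A; so a lift only has to be chosen k-linearly on X. *)
Lemma tensmod_bimod_projective (P : lmodType (envalg A B)) (X : lmodType B) :
  fin_gen P -> projective P -> fin_gen X -> projective (tensmod P X).
Proof.
move=> fP pP fX Y Z q f sq.
have [n [g [s hs]]] := dual_basis fP pP.
pose phiA : {rmorphism k -> A} := in_alg A.
pose phiB : {rmorphism k -> B} := in_alg B.
have pX : projective (kmod phiB X).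
  by apply: fin_gen_projective; apply: (@fin_gen_kmod k B phiB _ _ (@alg_gen k B)).
have q_lin : linear (q : kmod phiA Y -> kmod phiA Z).
  by move=> c x y; apply: (linearP q).
have f_lin i : linear (fun x : kmod phiB X => f (mpure (g i) (x : X)) : kmod phiA Z).
  move=> c x y; rewrite mpureDr linearD; congr (_ + _).
  rewrite !kmodZ -mpureM /phiA /phiB /= -lactk -tensmod_scaleE.
  exact: linearZ.
have /choice[l hl] i := pX _ _ (mklin q_lin) (mklin (f_lin i)) sq.
have e_bal i (x : X) : balanced (fun (a : A) (c : k) => c *: a) (fun (c : k) (b : B) => c *: b)
    (fun (a : A) (b : B) => a *: (l i (b *: x : X) : Y)).
  split=> [a a' b|a b b'|a c b].
  - exact: scalerDl.
  - rewrite -scalerDr scalerDl; congr (_ *: _); exact: (linearD (l i)).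
  - rewrite -{1}[a]mulr1 scalerAr -scalerA; congr (_ *: _).
    have := linearZ_LR (l i) c (b *: x : kmod phiB X).
    rewrite !kmodZ /phiA /phiB /= scalerA -scalerAl mul1r => ->; by [].
(* e i z x is a lift of f ((z *: g i) (x) x), see qe *)
pose e i (z : envalg A B) (x : X) : Y :=
  tlift (fun (a : A) (b : B) => a *: (l i (b *: x : X) : Y)) z.
have eD i z z' x : e i (z + z') x = e i z x + e i z' x := tliftD (e_bal i x) z z'.
have e0 i x : e i 0 x = 0 := tlift0 (e_bal i x).
have eE i a b x : e i (epure a b) x = a *: (l i (b *: x) : Y) := tliftE (e_bal i x) a b.
have eDr i z x y : e i z (x + y) = e i z x + e i z y.
  elim/envalg_ind: z => [|z w hz hw|a b]; first by rewrite !e0 addr0.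
    by rewrite !eD hz hw addrACA.
  by rewrite !eE -scalerDr (scalerDr b); congr (_ *: _); apply: (linearD (l i)).
have eR i z b x : e i (epure 1 b * z) x = e i z (b *: x).
  elim/envalg_ind: z => [|z w hz hw|a c]; first by rewrite mulr0 !e0.
    by rewrite mulrDr !eD hz hw.
  by rewrite epureM !eE mul1r scalerA.
have eL i z a x : e i (epure a 1 * z) x = a *: e i z x.
  elim/envalg_ind: z => [|z w hz hw|a' c]; first by rewrite mulr0 !e0 scaler0.
    by rewrite mulrDr !eD hz hw scalerDr.
  by rewrite epureM !eE mulr1 scalerA.
have qe i z x : q (e i z x) = f (mpure (z *: g i) x).
  elim/envalg_ind: z => [|z w hz hw|a b].
  - by rewrite e0 scale0r mpure0l !linear0.
  - by rewrite eD linearD hz hw scalerDl mpureDl linearD.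
  - rewrite eE linearZ epure_act -tensmod_scaleE mpureM linearZ; congr (_ *: _).
    exact: (hl i).
have b_bal : balanced (@ract k A B P) (fun (b : B) (x : X) => b *: x)
    (fun m x => \sum_i e i (s i m) x).
  split=> [m m' x|m x y|m b x].
  - by rewrite -big_split; apply: eq_bigr => i _; rewrite linearD eD.
  - by rewrite -big_split; apply: eq_bigr => i _; rewrite eDr.
  - by apply: eq_bigr => i _; rewrite linearZ eR.
have [|h hh] := tensmod_lift b_bal.
  by move=> a m x; rewrite scaler_sumr; apply: eq_bigr => i _; rewrite linearZ eL.
exists h; apply: (@tensmod_ext P X _ (q \o h) f) => m x.
rewrite /= hh linear_sum {2}[m](hs m) mpure_suml linear_sum.
by apply: eq_bigr => i _; rewrite qe.
Qed.

End TensorMaps.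

(** * Associativity, unit, and Gorenstein dimension zero of tensor products *)

Section Associativity.
Variables (k : fieldType) (A B C : falgType k).
Variables (M : lmodType (envalg A B)) (N : lmodType (envalg B C)).

Lemma lact_bpure a m (n : N) : lact a (bpure m n : tensbimod M N) = bpure (lact a m) n.
Proof. by rewrite {1}/lact [LHS]tb_actE ract1. Qed.
Lemma ract_bpure (m : M) n c : ract (bpure m n : tensbimod M N) c = bpure m (ract n c).
Proof. by rewrite {1}/ract [LHS]tb_actE lact1. Qed.

Variable X : lmodType C.

Lemma tassoc_exists :
  exists f : {linear tensmod M (tensmod N X) -> tensmod (tensbimod M N) X},
    forall m n x, f (mpure m (mpure n x)) = mpure (bpure m n : tensbimod M N) x.
Proof.
have bal0 m : balanced (@ract k B C N) (fun (c : C) (x : X) => c *: x)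
    (fun n x => mpure (bpure m n : tensbimod M N) x).
  split=> [n n' x|n x y|n c x].
  - by rewrite bpureDr mpureDl.
  - exact: mpureDr.
  - by rewrite -ract_bpure mpureM.
pose b (m : M) (t : tensmod N X) := tlift (fun n x => mpure (bpure m n : tensbimod M N) x) t.
have bD m : {morph b m : s t / s + t} := tliftD (bal0 m).
have b0 m : b m 0 = 0 := tlift0 (bal0 m).
have bE m n x : b m (mpure n x) = mpure (bpure m n : tensbimod M N) x := tliftE (bal0 m) n x.
have bal : balanced (@ract k A B M) (fun (c : B) (t : tensmod N X) => c *: t) b.
  split=> [m m' t|m s t|m c t]; last 1 first.
  - elim/tensmod_ind: t => [|s t hs ht|n x]; first by rewrite scaler0 !b0.
      by rewrite scalerDr !bD hs ht.
    by rewrite tensmod_scaleE !bE bpureM.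
  - elim/tensmod_ind: t => [|s t hs ht|n x]; first by rewrite !b0 addr0.
      by rewrite !bD hs ht addrACA.
    by rewrite !bE bpureDl mpureDl.
  - exact: bD.
have [|f hf] := tensmod_lift bal.
  move=> a m t; elim/tensmod_ind: t => [|s t hs ht|n x]; first by rewrite !b0 scaler0.
    by rewrite !bD hs ht scalerDr.
  by rewrite !bE tensmod_scaleE lact_bpure.
by exists f => m n x; rewrite hf bE.
Qed.

Lemma tassoc_inv_exists :
  exists f : {linear tensmod (tensbimod M N) X -> tensmod M (tensmod N X)},
    forall m n x, f (mpure (bpure m n : tensbimod M N) x) = mpure m (mpure n x).
Proof.
have bal0 (x : X) : balanced (@ract k A B M) (@lact k B C N)
    (fun m n => mpure m (mpure n x) : tensmod M (tensmod N X)).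
  split=> [m m' n|m n n'|m c n].
  - exact: mpureDl.
  - by rewrite mpureDl mpureDr.
  - by rewrite mpureM tensmod_scaleE.
pose b (w : tensbimod M N) (x : X) : tensmod M (tensmod N X) :=
  tlift (fun m n => mpure m (mpure n x)) w.
have bD x : {morph b^~ x : s t / s + t} := tliftD (bal0 x).
have b0 x : b 0 x = 0 := tlift0 (bal0 x).
have bE m n x : b (bpure m n) x = mpure m (mpure n x) := tliftE (bal0 x) m n.
have bal : balanced (@ract k A C (tensbimod M N)) (fun (c : C) (x : X) => c *: x) b.
  split=> [w w' x|w x y|w c x]; first exact: bD.
  - elim/tensbimod_ind: w => [|s t hs ht|m n]; first by rewrite !b0 addr0.
      by rewrite !bD hs ht addrACA.
    by rewrite !bE !mpureDr.
  - elim/tensbimod_ind: w => [|s t hs ht|m n]; first by rewrite /ract scaler0 !b0.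
      by rewrite ractDl !bD hs ht.
    by rewrite ract_bpure !bE mpureM.
have [|f hf] := tensmod_lift bal.
  move=> a w x; elim/tensbimod_ind: w => [|s t hs ht|m n].
  - by rewrite /lact scaler0 b0 scaler0.
  - by rewrite lactDr !bD hs ht scalerDr.
  - by rewrite lact_bpure !bE tensmod_scaleE.
by exists f => m n x; rewrite hf bE.
Qed.

Definition tassoc := projT1 (cid tassoc_exists).
Definition tassoc_inv := projT1 (cid tassoc_inv_exists).
Lemma tassocE m n x : tassoc (mpure m (mpure n x)) = mpure (bpure m n : tensbimod M N) x.
Proof. exact: (projT2 (cid tassoc_exists)). Qed.
Lemma tassoc_invE m n x :
  tassoc_inv (mpure (bpure m n : tensbimod M N) x) = mpure m (mpure n x).
Proof. exact: (projT2 (cid tassoc_inv_exists)). Qed.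

Lemma tensmod2_ind (P : tensmod M (tensmod N X) -> Prop) :
  P 0 -> (forall s t, P s -> P t -> P (s + t)) ->
  (forall m n x, P (mpure m (mpure n x))) -> forall t, P t.
Proof.
move=> P0 PD PE; elim/tensmod_ind=> // m t.
elim/tensmod_ind: t => [|s t hs ht|n x] //; first by rewrite mpure0r.
by rewrite mpureDr; apply: PD.
Qed.

Lemma tassocK t : tassoc_inv (tassoc t) = t.
Proof.
elim/tensmod2_ind: t => [|s t hs ht|m n x]; rewrite ?linear0 //.
  by rewrite !linearD hs ht.
by rewrite tassocE tassoc_invE.
Qed.

Lemma tassoc_invK t : tassoc (tassoc_inv t) = t.
Proof.
elim/tensmod_ind: t => [|s t hs ht|w x]; rewrite ?linear0 //.
  by rewrite !linearD hs ht.
elim/tensbimod_ind: w => [|s t hs ht|m n]; first by rewrite mpure0l !linear0.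
  by rewrite mpureDl !linearD hs ht.
by rewrite tassoc_invE tassocE.
Qed.

End Associativity.

Lemma tassoc_natural (k : fieldType) (A B C : falgType k) (M : lmodType (envalg A B))
    (N : lmodType (envalg B C)) (X Y : lmodType C) (f : {linear X -> Y}) t :
  tassoc M N Y (tmap M (tmap N f) t) = tmap (tensbimod M N) f (tassoc M N X t).
Proof.
elim/tensmod2_ind: t => [|s t hs ht|m n x]; first by rewrite !linear0.
  by rewrite !linearD hs ht.
by rewrite tassocE !tmapE tassocE.
Qed.

Section Unit.
Variables (k : fieldType) (A : falgType k).

Lemma lact_reg (a : A) (r : regbimod A) : lact a r = (a * (r : A) : A).
Proof. by rewrite /lact [LHS]reg_act_pure mulr1. Qed.
Lemma ract_reg (a : A) (r : regbimod A) : ract r a = ((r : A) * a : A).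
Proof. by rewrite /ract [LHS]reg_act_pure mul1r. Qed.

Lemma rres_reg_projective : projective (rres (regbimod A)).
Proof.
move=> X Y p f sp; have [x hx] := sp (f (1 : A)).
have g_lin : linear (fun r : rres (regbimod A) => (r : A^c) *: x).
  move=> a r s; rewrite scalerA -scalerDl; congr (_ *: _); congr (_ + _).
  exact: ract_reg.
exists (mklin g_lin) => r; rewrite linearZ hx -linearZ; congr (f _).
by rewrite [LHS]ract_reg mul1r.
Qed.

Variable X : lmodType A.

Lemma tunit_exists : exists f : {linear tensmod (regbimod A) X -> X},
  forall r x, f (mpure (r : regbimod A) x) = (r : A) *: x.
Proof.
apply: tensmod_lift => [|a r x]; last by rewrite lact_reg scalerA.
split=> [r r' x|r x y|r a x]; first exact: scalerDl.
  exact: scalerDr.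
by rewrite ract_reg scalerA.
Qed.
Definition tunit := projT1 (cid tunit_exists).
Lemma tunitE (r : A) x : tunit (mpure (r : regbimod A) x) = r *: x.
Proof. exact: (projT2 (cid tunit_exists)). Qed.

Lemma tunit_inv_linear : linear (fun x : X => mpure (1 : regbimod A) x).
Proof.
move=> a x y; rewrite mpureDr tensmod_scaleE -mpureM; congr (mpure _ _ + _).
by rewrite lact_reg ract_reg mulr1 mul1r.
Qed.
Definition tunit_inv : {linear X -> tensmod (regbimod A) X} := mklin tunit_inv_linear.

Lemma tunit_invK x : tunit (tunit_inv x) = x.
Proof. by rewrite [LHS]tunitE scale1r. Qed.
Lemma tunitK t : tunit_inv (tunit t) = t.
Proof.
elim/tensmod_ind: t => [|s t hs ht|r x]; rewrite ?linear0 //.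
  by rewrite !linearD hs ht.
rewrite tunitE linearZ /= [X in _ *: X = _]/= tensmod_scaleE; congr mpure.
by rewrite lact_reg mulr1.
Qed.

End Unit.

Lemma tunit_natural (k : fieldType) (A : falgType k) (X Y : lmodType A) (f : {linear X -> Y}) t :
  tunit Y (tmap (regbimod A) f t) = f (tunit X t).
Proof.
elim/tensmod_ind: t => [|s t hs ht|r x]; first by rewrite !linear0.
  by rewrite !linearD hs ht.
by rewrite tmapE !tunitE linearZ.
Qed.

Section TensorGorenstein.
Variables (k : fieldType) (A B : falgType k) (M : lmodType (envalg A B)).
Hypotheses (fM : fin_gen M) (pM : projective (lres M)) (pM' : projective (rres M)).

(** Adjunction: phi : M (x) K -> A corresponds to z |-> (m |-> phi(m (x) z)), a
    left B-linear map K -> Hom_A(M, A), and likewise for P. *)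
Lemma tensor_extends (K P : lmodType B) (i : {linear K -> P}) :
  extends (bidual M) i -> extends A^o (tmap M i).
Proof.
move=> ex phi.
have c_lin (z : K) : linear (fun m : lres M => phi (mpure (m : M) z)).
  by move=> a m n; rewrite mpureDl -tensmod_scaleE linearP.
pose c (z : K) : bidual M := mklin (c_lin z).
have cl : linear c.
  move=> b z w; apply: homP => m.
  rewrite [LHS]/hom_fun /c /mklin /= /lin_fun mpureDr linearD -mpureM; by [].
have [g hg] := ex (mklin cl).
have bal : balanced (@ract k A B M) (fun (b : B) (x : P) => b *: x)
    (fun m y => hom_fun (g y) (m : lres M) : A^o).
  split=> [m m' y|m y y'|m b y].
  - exact: (linearD (g y : {linear lres M -> A^o})).
  - by rewrite linearD.
  - by rewrite linearZ.
have [|psi hpsi] := tensmod_lift bal.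
  by move=> a m y; apply: (linearZ_LR (g y : {linear lres M -> A^o}) a m).
exists psi; apply: (@tensmod_ext _ _ _ M K _ (psi \o tmap M i) phi) => m z.
by rewrite /= tmapE hpsi hg.
Qed.

(** The modules M (x) X with X of Gorenstein dimension zero satisfy the closure
    conditions of [class_gorenstein]. *)
Lemma tensor_gorenstein (X : lmodType B) : finite_projdim (bidual M) ->
  gorenstein_dim0 X -> gorenstein_dim0 (tensmod M X).
Proof.
move=> [d pd] gX.
have [nB nBc] := (@falg_noetherian k B, @falg_op_noetherian k B).
apply: (@class_gorenstein A
  (fun Y => exists2 X : lmodType B, gorenstein_dim0 X & Y = tensmod M X)); last by exists X.
move=> {gX X} _ [X gX ->]; have [fX _ _ _] := gX; split.
- exact: tensmod_fin_gen.
- have [c [fP _]] := fin_gen_cover_noetherian nB fX.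
  have [pP se] := (cov_proj c, cov_exact c).
  exists (tensmod M (cov_K c)), (tensmod M (cov_P c)), (tmap M (cov_i c)), (tmap M (cov_p c)).
  split; first exact: tensmod_projective.
  + exact: tmap_short_exact.
  + by exists (cov_K c) => //; apply: (gorenstein_syzygy nB nBc gX fP pP se).
  + exact/tensor_extends/(gorenstein_extends_projdim nB nBc pd gX fP pP se).
- have [Q [X' [i [p [fQ pQ se gX']]]]] := gorenstein_cosyzygy nB nBc gX.
  exists (tensmod M Q), (tensmod M X'), (tmap M i), (tmap M p); split.
  + exact: tensmod_fin_gen.
  + exact: tensmod_projective.
  + exact: tmap_short_exact.
  + by exists X'.
Qed.

End TensorGorenstein.

Section SyzygyChain.
Variable R : pzRingType.

(** [is_syzygy] takes the first syzygy first, whereas [functor_iter] applies the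
    syzygy functor last; here the n-th syzygy is split off from the end. *)
Fixpoint syz_chain (n : nat) (Z W : lmodType R) : Prop :=
  if n is m.+1 then
    exists V, syz_chain m Z V /\
      exists (P : lmodType R) (i : {linear W -> P}) (p : {linear P -> V}),
        [/\ fin_gen P, projective P & short_exact i p]
  else Z = W.

Lemma syz_chain_cons n (Z K W P : lmodType R) (i : {linear K -> P}) (p : {linear P -> Z}) :
  fin_gen P -> projective P -> short_exact i p -> syz_chain n K W -> syz_chain n.+1 Z W.
Proof.
move=> fP pP se; elim: n W => [|n IHn] W.
  by move=> <-; exists Z; split=> //; exists P, i, p.
by move=> [V [/IHn hV hW]]; exists V.
Qed.

Lemma is_syzygy_chain n (Z Y : lmodType R) : is_syzygy n Z Y ->
  exists W, syz_chain n Z W /\ stable_iso Y W.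
Proof.
elim: n Z => [|n IHn] Z; first by exists Z.
move=> [P [K [i [p [fP pP se /IHn[W [cW iW]]]]]]]; exists W; split=> //.
exact: syz_chain_cons se cW.
Qed.

End SyzygyChain.

(** * Tensoring with syzygies of the regular bimodule *)

Section StableTransport.
Variable R : pzRingType.
Implicit Types X Y Z : lmodType R.

Lemma stable_retract_comp X Y Z (f : {linear X -> Y}) (g : {linear Y -> X})
    (f' : {linear Y -> Z}) (g' : {linear Z -> Y}) :
  stable_eq (g \o f) idfun -> stable_eq (g' \o f') idfun ->
  stable_eq ((g \o g') \o (f' \o f)) idfun.
Proof.
move=> gf gf'; apply: stable_eq_trans gf.
apply: (@stable_eq_trans _ _ _ _ ((g \o idfun) \o f)); last exact: stable_eq_ext.
apply: (@stable_eq_trans _ _ _ _ ((g \o (g' \o f')) \o f)); first exact: stable_eq_ext.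
by apply: stable_eq_comp (stable_eq_refl _); apply: stable_eq_comp (stable_eq_refl _) _.
Qed.

Lemma stable_square_comp X X' Y Y' Z Z' (t : {linear X -> Y}) (t' : {linear X' -> Y'})
    (s : {linear Y -> Z}) (s' : {linear Y' -> Z'})
    (f : {linear X -> X'}) (g : {linear Y -> Y'}) (h : {linear Z -> Z'}) :
  stable_eq (t' \o f) (g \o t) -> stable_eq (s' \o g) (h \o s) ->
  stable_eq ((s' \o t') \o f) (h \o (s \o t)).
Proof.
move=> e e'.
apply: (@stable_eq_trans _ _ _ _ (s' \o (t' \o f))); first exact: stable_eq_ext.
apply: (@stable_eq_trans _ _ _ _ (s' \o (g \o t))).
  exact: stable_eq_comp (stable_eq_refl _) e.
apply: (@stable_eq_trans _ _ _ _ ((s' \o g) \o t)); first exact: stable_eq_ext.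
apply: (@stable_eq_trans _ _ _ _ ((h \o s) \o t)); last exact: stable_eq_ext.
exact: stable_eq_comp e' (stable_eq_refl _).
Qed.

End StableTransport.

Section BimoduleStable.
Variables (k : fieldType) (A B : falgType k).
Implicit Types M : lmodType (envalg A B).

(** A map through a projective bimodule P induces one through P (x) X, which is
    projective. *)
Lemma tmapl_stable M M' (phi psi : {linear M -> M'}) (X : lmodType B) :
  fin_gen X -> stable_eq phi psi -> stable_eq (tmapl phi X) (tmapl psi X).
Proof.
move=> fX [P [u [v [fP pP e]]]].
exists (tensmod P X), (tmapl u X), (tmapl v X); split.
- exact: tensmod_fin_gen.
- exact: tensmod_bimod_projective.
elim/tensmod_ind=> [|s t hs ht|m x]; first by rewrite !linear0 addr0.
  by rewrite !linearD addrACA; congr (_ + _).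
rewrite !tmaplE -e; apply: (addIr (mpure (psi m) x)).
by rewrite -mpureDl !subrK.
Qed.

Lemma tmapl_stable_retract M M' (phi : {linear M -> M'}) (psi : {linear M' -> M})
    (X : lmodType B) :
  fin_gen X -> stable_eq (psi \o phi) idfun ->
  stable_eq (tmapl psi X \o tmapl phi X) idfun.
Proof.
move=> fX e; apply: stable_eq_trans (stable_eq_trans (tmapl_stable fX e) _).
  apply: stable_eq_ext; apply: tensmod_ext => m x.
  by rewrite /= !tmaplE.
by apply: stable_eq_ext; apply: tensmod_ext => m x; rewrite tmaplE.
Qed.

End BimoduleStable.

Section SyzygyTensor.
Variables (k : fieldType) (A : falgType k).
Let S := syz_functor (@falg_noetherian k A) (@falg_op_noetherian k A).

(** A natural isomorphism in the stable category, from an assignment T that is a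
    functor on modules: at intermediate steps T is tensoring with a syzygy
    bimodule, which is not turned into a functor of stable categories. *)
Definition stable_family_iso
    (T : forall X : stG A, lmodType A)
    (Tm : forall X Y : stG A, {linear stG_mod X -> stG_mod Y} -> {linear T X -> T Y})
    (F : functor (stG A) (stG A)) : Prop :=
  exists (t : forall X : stG A, {linear T X -> stG_mod (F X)})
         (s : forall X : stG A, {linear stG_mod (F X) -> T X}),
    [/\ forall X, stable_eq (s X \o t X) idfun,
        forall X, stable_eq (t X \o s X) idfun
      & forall (X Y : stG A) (f : {linear stG_mod X -> stG_mod Y}),
          stable_eq (t Y \o Tm X Y f)
            ((fmap F (f : mor X Y) : {linear stG_mod (F X) -> stG_mod (F Y)}) \o t X)].

(** Tensoring 0 -> W -> P -> V -> 0 with X presents V (x) X with a projective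
    middle term, so the stable isomorphism V (x) X = Omega^n X lifts to
    W (x) X = Omega^(n+1) X; it stays natural because both ways around the square
    lift the same stable map. *)
Lemma syz_chain_tensor n (W : lmodType (envalg A A)) :
  syz_chain n (regbimod A) W ->
  projective (rres W) /\
  @stable_family_iso (fun X => tensmod W (stG_mod X)) (fun X Y f => tmap W f)
    (functor_iter n S).
Proof.
elim: n W => [|n IHn] W /=.
  move=> <-; split; first exact: rres_reg_projective.
  exists (fun X => tunit (stG_mod X)), (fun X => tunit_inv (stG_mod X)); split=> [X|X|X Y f];
    apply: stable_eq_ext => t.
  - exact: tunitK.
  - exact: tunit_invK.
  - exact: tunit_natural.
move=> [V [/IHn[pV [t [s [st ts nat]]]] [P [i [p [fP pP se]]]]]].
have [tse pW] := tmapl_short_exact se pV; split.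
  by apply: pW; apply: rres_projective.
have fX (X : stG A) : fin_gen (stG_mod X) := fgmodP (sval X).
have fPX (X : stG A) : fin_gen (tensmod P (stG_mod X)) by apply: tensmod_fin_gen.
have pPX (X : stG A) : projective (tensmod P (stG_mod X)) by apply: tensmod_bimod_projective.
pose F := functor_iter n S.
have sse (X : stG A) := syz_exact (@falg_noetherian k A) (F X).
have sP (X : stG A) := @syz_fgP _ (@falg_noetherian k A) (F X).
have spP (X : stG A) := @syz_proj _ (@falg_noetherian k A) (F X).
have [t1 ht1] : exists t1 : forall X, {linear tensmod W (stG_mod X) -> stG_mod (S (F X))},
    forall X, is_lift (tmapl i (stG_mod X)) (tmapl p (stG_mod X))
      (syz_i (@falg_noetherian k A) (F X)) (syz_p (@falg_noetherian k A) (F X)) (t X) (t1 X).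
  pose c X := cid (lift_exists (tse (stG_mod X)) (sse X) (pPX X) (t X)).
  by exists (fun X => projT1 (c X)) => X; apply: (projT2 (c X)).
have [s1 hs1] : exists s1 : forall X, {linear stG_mod (S (F X)) -> tensmod W (stG_mod X)},
    forall X, is_lift (syz_i (@falg_noetherian k A) (F X)) (syz_p (@falg_noetherian k A) (F X))
      (tmapl i (stG_mod X)) (tmapl p (stG_mod X)) (s X) (s1 X).
  pose c X := cid (lift_exists (sse X) (tse (stG_mod X)) (spP X) (s X)).
  by exists (fun X => projT1 (c X)) => X; apply: (projT2 (c X)).
exists t1, s1; split=> [X|X|X Y f].
- exact: stable_iso_lift (tse _) (sse X) (fPX X) (pPX X) (st X) (ht1 X) (hs1 X).
- exact: stable_iso_lift (sse X) (tse _) (sP X) (spP X) (ts X) (hs1 X) (ht1 X).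
- have lf : is_lift (tmapl i (stG_mod X)) (tmapl p (stG_mod X)) (tmapl i (stG_mod Y))
      (tmapl p (stG_mod Y)) (tmap V f) (tmap W f).
    by exists (tmap P f); split=> z; rewrite tmap_tmapl.
  have l1 := lift_comp (ht1 Y) lf.
  have lS := syz_fmapP (@falg_noetherian k A) (@falg_op_noetherian k A) (fmap F (f : mor X Y)).
  have l2 := lift_comp lS (ht1 X).
  have H := lift_stable_eq (tse _) (sse Y) (fPX X) (pPX X) (nat X Y f) l1 l2.
  exact: H.
Qed.

Lemma tensor_level (B : falgType k) n (M : lmodType (envalg A B)) (N : lmodType (envalg B A)) :
  is_syzygy n (regbimod A) (tensbimod M N) ->
  @stable_family_iso (fun X => tensmod M (tensmod N (stG_mod X)))
    (fun X Y f => tmap M (tmap N f)) (functor_iter n S).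
Proof.
move=> /is_syzygy_chain[W [cW [phi [psi [pp' pp]]]]].
have [_ [t [s [st ts nat]]]] := syz_chain_tensor cW.
have fX (X : stG A) : fin_gen (stG_mod X) := fgmodP (sval X).
exists (fun X => t X \o (tmapl phi (stG_mod X) \o tassoc M N (stG_mod X))).
exists (fun X => (tassoc_inv M N (stG_mod X) \o tmapl psi (stG_mod X)) \o s X).
split=> [X|X|X Y f].
- apply: stable_retract_comp (st X); apply: stable_retract_comp.
    by apply: stable_eq_ext => z; apply: tassocK.
  exact: tmapl_stable_retract.
- apply: (@stable_eq_trans _ _ _ _ ((t X \o (tmapl phi (stG_mod X) \o tassoc M N (stG_mod X))) \o
    ((tassoc_inv M N (stG_mod X) \o tmapl psi (stG_mod X)) \o s X))).
    exact: stable_eq_refl.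
  apply: stable_retract_comp (ts X) _; apply: stable_retract_comp.
    exact: tmapl_stable_retract.
  by apply: stable_eq_ext => z; apply: tassoc_invK.
- apply: stable_square_comp (nat X Y f); apply: (stable_square_comp (g := tmap _ f)).
    by apply: stable_eq_ext => z; apply: tassoc_natural.
  by apply: stable_eq_ext => z; rewrite /= tmap_tmapl.
Qed.

End SyzygyTensor.

(** * The two tensor functors *)

Lemma tensor_nat_iso (k : fieldType) (A B : falgType k) (M : lmodType (envalg A B))
    (N : lmodType (envalg B A)) (fM : fin_gen M) (pM : projective (lres M))
    (fN : fin_gen N) (pN : projective (lres N))
    (GM : forall X : fgmod B, gorenstein_dim0 X -> gorenstein_dim0 (tensmod M X))
    (GN : forall X : fgmod A, gorenstein_dim0 X -> gorenstein_dim0 (tensmod N X))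
    (H : functor (stG A) (stG A)) :
  @stable_family_iso _ _ (fun X => tensmod M (tensmod N (stG_mod X)))
    (fun X Y f => tmap M (tmap N f)) H ->
  nat_iso (functor_comp (restrict (F := tensor_functor fM pM) GM)
                        (restrict (F := tensor_functor fN pN) GN)) H.
Proof.
move=> [t [s [st ts nat]]]; exists t, s; split; [exact: st | exact: ts |].
by move=> X Y f; apply: (nat X Y f).
Qed.

Theorem proposition4p5 (k : fieldType) (A B : falgType k)
    (gldimA : infinite_gldim A) (gldimB : infinite_gldim B) (n : nat)
    (M : lmodType (envalg A B)) (N : lmodType (envalg B A))
    (MN : singular_equivalence_with_level n M N)
    (pdM : finite_projdim (bidual M)) (pdN : finite_projdim (bidual N)) :
  exists (GM : forall X : fgmod B, gorenstein_dim0 X -> gorenstein_dim0 (tensmod M X))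
         (GN : forall X : fgmod A, gorenstein_dim0 X -> gorenstein_dim0 (tensmod N X)),
    let F : functor (stG B) (stG A) :=
      restrict (F := tensor_functor (se_fgM MN) (se_projM MN)) GM in
    let G : functor (stG A) (stG B) :=
      restrict (F := tensor_functor (se_fgN MN) (se_projN MN)) GN in
    is_equivalence F /\ is_equivalence G /\
    exists (SA : functor (stG A) (stG A)) (SB : functor (stG B) (stG B)),
      is_syzygy_functor SA /\ is_syzygy_functor SB /\
      quasi_inverse_up_to (functor_iter n SB) (functor_iter n SA) F G.
Proof.
have [fM fN pM pM' pN pN' isM isN] := MN.
exists (fun X gX => tensor_gorenstein fM pM pM' pdM gX).
exists (fun X gX => tensor_gorenstein fN pN pN' pdN gX) => F G.
pose SA := syz_functor (@falg_noetherian k A) (@falg_op_noetherian k A).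
pose SB := syz_functor (@falg_noetherian k B) (@falg_op_noetherian k B).
have GF : nat_iso (functor_comp G F) (functor_iter n SB).
  by apply: tensor_nat_iso; apply: tensor_level.
have FG : nat_iso (functor_comp F G) (functor_iter n SA).
  by apply: tensor_nat_iso; apply: tensor_level.
have wSA := syz_weak_equivalence (@falg_noetherian k A) (@falg_op_noetherian k A).
have wSB := syz_weak_equivalence (@falg_noetherian k B) (@falg_op_noetherian k B).
have wGF := weak_equivalence_nat_iso GF (weak_equivalence_iter n wSB).
have wFG := weak_equivalence_nat_iso FG (weak_equivalence_iter n wSA).
split; first exact/weak_equivalence_is_equivalence/(weak_equivalence_factor wGF wFG).
split; first exact/weak_equivalence_is_equivalence/(weak_equivalence_factor wFG wGF).
exists SA, SB; split; first exact: syz_functorP.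
by split; first exact: syz_functorP.
Qed.
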